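(* Let $n\ge1$, $\lambda>0$, let $\boldsymbol p$ be a partition of $n$ and $1\le i\le\chi_{\boldsymbol p}(1)$. The Taylor joint spectrum of the $n$-tuple $\big(M_{s_1}^{(\boldsymbol p,i)},\dots,M_{s_n}^{(\boldsymbol p,i)}\big)$ is $\Gamma_n$.
   Context: $\mathbb D^n$ is the open unit polydisc in $\mathbb C^n$. $\mathbb A^{(\lambda)}(\mathbb D^n)$ is the Hilbert space of holomorphic functions on $\mathbb D^n$ with reproducing kernel $\prod_{j=1}^n(1-z_j\bar w_j)^{-\lambda}$. The symmetric group $\mathfrak S_n$ acts on $\mathbb C^n$ by $\sigma\cdot\boldsymbol z=(z_{\sigma^{-1}(1)},\dots,z_{\sigma^{-1}(n)})$, and $(f\circ\sigma^{-1})(\boldsymbol z)=f(\sigma^{-1}\cdot\boldsymbol z)$. For a partition $\boldsymbol p$ of $n$ fix a unitary matrix representation $\boldsymbol\pi_{\boldsymbol p}=(\boldsymbol\pi_{\boldsymbol p}^{ij})$ in the class of irreducible representations of $\mathfrak S_n$ corresponding to $\boldsymbol p$, with character $\chi_{\boldsymbol p}$ and dimension $\chi_{\boldsymbol p}(1)$. Define $\mathbb P_{\boldsymbol p}^{ii}f=\frac{\chi_{\boldsymbol p}(1)}{n!}\sum_{\sigma\in\mathfrak S_n}\boldsymbol\pi_{\boldsymbol p}^{ii}(\sigma^{-1})(f\circ\sigma^{-1})$, an orthogonal projection on $\mathbb A^{(\lambda)}(\mathbb D^n)$. $s_k$ is the $k$-th elementary symmetric polynomial in $z_1,\dots,z_n$,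 $\boldsymbol s=(s_1,\dots,s_n)$, $M_{s_k}$ is multiplication by $s_k$ on $\mathbb A^{(\lambda)}(\mathbb D^n)$, and $M_{s_k}^{(\boldsymbol p,i)}$ is its restriction to the reducing subspace $\mathbb P_{\boldsymbol p}^{ii}\big(\mathbb A^{(\lambda)}(\mathbb D^n)\big)$. $\Gamma_n=\boldsymbol s(\overline{\mathbb D}^{\,n})$ is the closure of the symmetrized polydisc $\boldsymbol s(\mathbb D^n)$. *)

(* Defs.v *)
From HB Require Import structures.
From mathcomp Require Import all_boot all_order all_algebra all_fingroup.
From mathcomp Require Import all_character complex.
From mathcomp Require Import all_classical all_reals all_analysis.

Set Implicit Arguments.
Unset Strict Implicit.
Unset Printing Implicit Defensive.

Import Order.TTheory GRing.Theory Num.Theory.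
Import numFieldNormedType.Exports.

Local Open Scope classical_set_scope.
Local Open Scope ring_scope.
Local Open Scope complex_scope.

HB.instance Definition _ (R : realType) := NormedModule.copy R[i] R[i]^o.

Section TaylorSpectrum.
Variables (K : fieldType) (V : lmodType K) (n : nat).

(* An element of V (x) /\(K^n) is a family x indexed by the subsets of 'I_n:
   x S is the coefficient of e_S = e_(i_1) /\ ... /\ e_(i_r), where
   S = {i_1 < ... < i_r}.  The sign is that of e_i /\ e_(S :\ i) = +/- e_S. *)
Definition koszul (T : 'I_n -> V -> V) (x : {set 'I_n} -> V) :
    {set 'I_n} -> V :=
  fun S => \sum_(i in S) (-1) ^+ #|[set j in S | (j < i)%N]%SET| *:
             T i (x (S :\ i)%SET).

(* Exactness of the Koszul complex of the restrictions of the T i to the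
   subspace X.  The equality of sets includes that the differential maps
   X-valued families to X-valued families, hence that X is T i-invariant. *)
Definition taylor_nonsingular (X : set V) (T : 'I_n -> V -> V) : Prop :=
  [set x | (forall S, X (x S)) /\ forall S, koszul T x S = 0] =
  koszul T @` [set y | forall S, X (y S)].

Definition taylor_spectrum (X : set V) (T : 'I_n -> V -> V) : set 'rV[K]_n :=
  [set mu | ~ taylor_nonsingular X (fun i v => T i v - mu 0 i *: v)].

End TaylorSpectrum.

Section HilbertFunctionSpace.
Variable R : realType.
Local Notation C := R[i].

Record hilbert_subspace (V : lmodType C) (H : set V) (dot : V -> V -> C) :
    Prop := HilbertSubspace {
  hs_zero : H 0 ;
  hs_linear : forall (a : C) u v, H u -> H v -> H (a *: u + v) ;
  hs_dotPl : forall (a : C) u v w, H u -> H v -> H w ->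
    dot (a *: u + v) w = a * dot u w + dot v w ;
  hs_dotC : forall u v, H u -> H v -> dot v u = (dot u v)^* ;
  hs_dot_gt0 : forall u, H u -> u != 0 -> 0 < dot u u ;
  hs_complete : forall u : nat -> V, (forall k, H (u k)) ->
    (forall e : C, 0 < e -> exists N, forall k l, (N <= k)%N -> (N <= l)%N ->
       dot (u k - u l) (u k - u l) < e) ->
    exists2 v, H v & forall e : C, 0 < e ->
      exists N, forall k, (N <= k)%N -> dot (u k - v) (u k - v) < e }.

(* A function on D is represented by its extension by 0 outside D. *)
Record rkhs (T : choiceType) (D : set T) (K : T -> T -> C)
    (H : set (T -> C)) (dot : (T -> C) -> (T -> C) -> C) :
    Prop := Rkhs {
  rkhs_hilbert : hilbert_subspace H dot ;
  rkhs_supp : forall f, H f -> forall z, ~ D z -> f z = 0 ;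
  rkhs_kernel : forall w, D w -> H ((K^~ w : T -> C) \_ D) ;
  rkhs_reproducing : forall f w, H f -> D w ->
    dot f ((K^~ w : T -> C) \_ D) = f w }.

(* z ^ a, principal branch, for 'Re z > 0. *)
Definition rhp_pow (z : C) (a : R) : C :=
  let: x +i* y := z in
  let r := Num.sqrt (x ^+ 2 + y ^+ 2) in
  let theta := atan (y / x) in
  (r `^ a * cos (a * theta)) +i* (r `^ a * sin (a * theta)).

End HilbertFunctionSpace.

Section Polydisc.
Variables (R : realType) (n : nat).
Local Notation C := R[i].

Definition polydisc : set 'rV[C]_n := [set z | forall j, `|z 0 j| < 1].

Definition closed_polydisc : set 'rV[C]_n := [set z | forall j, `|z 0 j| <= 1].

Definition polydisc_kernel (lambda : R) (z w : 'rV[C]_n) : C :=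
  \prod_(j < n) rhp_pow (1 - z 0 j * (w 0 j)^*) (- lambda).

Definition holomorphic_on (D : set 'rV[C]_n) (f : 'rV[C]_n -> C) : Prop :=
  forall z, D z -> differentiable f z.

Definition is_A_lambda (lambda : R) (H : set ('rV[C]_n -> C))
    (dot : ('rV[C]_n -> C) -> ('rV[C]_n -> C) -> C) : Prop :=
  rkhs polydisc (polydisc_kernel lambda) H dot /\
  forall f, H f -> holomorphic_on polydisc f.

Definition elem_sym (k : nat) (z : 'rV[C]_n) : C :=
  \sum_(A : {set 'I_n} | #|A| == k) \prod_(j in A) z 0 j.

(* The index k : 'I_n, counted from 0, stands for s_(k+1). *)
Definition symmetrization (z : 'rV[C]_n) : 'rV[C]_n :=
  \row_(k < n) elem_sym k.+1 z.

Definition Gamma : set 'rV[C]_n := symmetrization @` closed_polydisc.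

Definition mul_sym (k : 'I_n) (f : 'rV[C]_n -> C) : 'rV[C]_n -> C :=
  fun z => elem_sym k.+1 z * f z.

Definition perm_act (s : 'S_n) (z : 'rV[C]_n) : 'rV[C]_n :=
  \row_j z 0 ((s^-1)%g j).

End Polydisc.

Section Specht.
Variables (F : fieldType) (n : nat).

Definition is_partition_of (p : seq nat) : bool :=
  [&& sorted geq p, 0%N \notin p & sumn p == n].

(* The entries 0, ..., n-1 fill the Young diagram of p row by row: k lies in
   row reshape_index p k and column reshape_offset p k. *)
Definition row_stab (p : seq nat) : pred 'S_n :=
  fun s => [forall k, reshape_index p (s k) == reshape_index p k].

Definition col_stab (p : seq nat) : pred 'S_n :=
  fun s => [forall k, reshape_offset p (s k) == reshape_offset p k].

(* The Young symmetrizer, in the basis of the regular representation.  The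
   product of 'S_n is composition from left to right, so that c * r is the
   composite usually written r c. *)
Definition young_symmetrizer (p : seq nat) : 'rV[F]_#|[set: 'S_n]%G| :=
  \sum_(r | row_stab p r) \sum_(c | col_stab p c)
    (-1) ^+ c *: delta_mx 0 (gring_index [set: 'S_n]%G (c * r)%g).

Definition specht_repr (p : seq nat) :=
  submod_repr (cyclic_mx_module (regular_repr F [set: 'S_n]%G)
                                (young_symmetrizer p)).

Definition in_specht_class (p : seq nat) (d : nat)
    (rG : mx_representation F [set: 'S_n]%G d) : Prop :=
  mx_irreducible rG /\ mx_rsim rG (specht_repr p).

End Specht.

Section Projection.
Variables (R : realType) (n d : nat).
Local Notation C := R[i].

(* A mathcomp representation acts on row vectors, for the left-to-right product
   of 'S_n; a representation in the usual sense (matrices acting on columns,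
   permutations composed from right to left) is thus s |-> (rG s)^T, and this and rG
   have the same diagonal entries. *)
Definition unitary_repr (rG : mx_representation C [set: 'S_n]%G d) : Prop :=
  forall s, rG s \is unitarymx.

Definition isotypic_proj (rG : mx_representation C [set: 'S_n]%G d) (i : 'I_d)
    (f : 'rV[C]_n -> C) : 'rV[C]_n -> C :=
  fun z => d%:R / n`!%:R *
    \sum_(s : 'S_n) rG (s^-1)%g i i * f (perm_act (s^-1)%g z).

End Projection.

(* Main.v *)
(* Let W be the image of A^(lambda) under the projection.

   If mu = s(w) is not in Gamma, some coordinate a = w_j has |a| > 1, and
   prod_l (a - z_l) is a constant linear combination of the s_k(z) - mu_k.  It is
   symmetric, and multiplication by it is invertible on A^(lambda), hence on W.
   So an invertible combination of the operators of the tuple commutes with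
   everything, and contraction with its coefficients is a homotopy showing that
   the Koszul complex is exact.

   If mu = s(w) with w in the closed polydisc, choose points w_m of the open
   polydisc with distinct coordinates and tending to w.  Evaluation at w_m on W is
   nonzero, since a polynomial can separate the permutations of w_m.  Exactness
   in top degree would write every f in W as a combination of (s_k - mu_k) y_k,
   so that |f(w_m)| is O(|s(w_m) - mu|) times the norm of the evaluation; a
   gliding hump argument produces an f violating this.

   What is needed on A^(lambda) is read off the kernel.  A function f belongs to
   the space as soon as, with a constant M, |sum_i conj(c_i) f(w_i)| <= M
   |sum_i c_i K(., w_i)| for all finite families (Riesz), so a multiplier bound
   is a positivity statement about a kernel.  By the binomial series these follow
   from inequalities between the coefficients of (1 - t)^(-lambda), which also
   show that multiplication by z_j has spectral radius at most 1. *)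
Require Import Defs.
From HB Require Import structures.
From mathcomp Require Import all_boot all_order all_algebra all_fingroup.
From mathcomp Require Import all_character complex.
From mathcomp Require Import all_classical all_reals all_analysis.
From mathcomp Require Import ring lra.

Set Implicit Arguments.
Unset Strict Implicit.
Unset Printing Implicit Defensive.

Import Order.TTheory GRing.Theory Num.Theory.
Import numFieldNormedType.Exports.

Local Open Scope classical_set_scope.
Local Open Scope ring_scope.
Local Open Scope complex_scope.

(* Unqualified, Re and Im are Num.Re and Num.Im, and ^* is Num.conj or conjc
   depending on the scope. *)
Local Notation Re := (@complex.Re _).
Local Notation Im := (@complex.Im _).

Local Notation "z ^#" := (conjc z) : ring_scope.
Local Notation "z ^#" := (conjc z) : complex_scope.

(** * Koszul signs and the contraction homotopy, with scalar coefficients *)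

Section ScalarKoszul.
Variables (F : numFieldType) (n : nat).
Implicit Types (t c : 'I_n -> F) (x : {set 'I_n} -> F) (S : {set 'I_n}) (i j : 'I_n).

Definition ksign (i : 'I_n) S : F :=
  (-1) ^+ #|[set j in S | (j < i)%N]%SET|.

Lemma ksign_sqr i S : ksign i S * ksign i S = 1.
Proof. by rewrite /ksign -expr2 sqrr_sign. Qed.

Lemma ksignD1_ge i j S : (i <= j)%N -> ksign i (S :\ j) = ksign i S.
Proof.
move=> leij; rewrite /ksign; congr (_ ^+ _); apply: eq_card => l; rewrite !inE.
by case: eqVneq => [->|_] //=; rewrite ltnNge leij andbF.
Qed.

Lemma ksignD1_lt i j S : j \in S -> (j < i)%N -> ksign i (S :\ j) = - ksign i S.
Proof.
move=> jS ltji; rewrite /ksign [in RHS](cardsD1 j) inE jS ltji exprS mulN1r opprK //.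
by congr (_ ^+ _); apply: eq_card => l; rewrite !inE andbA.
Qed.

(** This is e_i /\ e_j = - e_j /\ e_i read on coefficients; it makes the square of the differential
    vanish. *)
Lemma ksign_swap i j S : i \in S -> j \in S -> i != j ->
  ksign i S * ksign j (S :\ i) = - (ksign j S * ksign i (S :\ j)).
Proof.
move=> iS jS; rewrite neq_ltn => /orP[] lt.
  by rewrite (ksignD1_lt iS lt) (ksignD1_ge _ (ltnW lt)) mulrN mulrC.
by rewrite (ksignD1_lt jS lt) (ksignD1_ge _ (ltnW lt)) mulrN opprK mulrC.
Qed.

(** The operators of the tuple are multiplications by functions, so at a fixed point z the
    differential [koszul] becomes this scalar one, with t the values at z. *)
Definition skoszul t x S := \sum_(i in S) ksign i S * (t i * x (S :\ i)).

(** Interior product with the covector c. For i outside S, the sign of i relative to S equals its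
    sign relative to [i |: S]. *)
Definition scontract c x S :=
  \sum_(i in ~: S) ksign i S * (c i * x (i |: S)).

Lemma setD1C S i j : S :\ i :\ j = S :\ j :\ i.
Proof. by apply/setP => l; rewrite !inE andbCA. Qed.

Lemma skoszul_skoszul t x S : skoszul t (skoszul t x) S = 0.
Proof.
pose G i j := ksign i S * (t i * (ksign j (S :\ i) * (t j * x (S :\ i :\ j)))).
have -> : skoszul t (skoszul t x) S = \sum_(i in S) \sum_(j in S | j != i) G i j.
  apply: eq_bigr => i iS; rewrite !mulr_sumr; apply: eq_big => j.
    by rewrite !inE andbC.
  by [].
(* Exchanging the two summations changes the sign of every term, and the characteristic is 0. *)
set a := LHS; suff: a = - a.
  by move/eqP; rewrite -addr_eq0 -mulr2n mulrn_eq0 /= => /eqP.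
rewrite {1}/a (exchange_big_dep (mem S)) /=; last by move=> i j _ /andP[].
rewrite /a -sumrN; apply: eq_bigr => j jS; rewrite -sumrN.
apply: eq_big => [i|i /andP[iS]]; first by rewrite jS /= eq_sym.
move=> /andP[_ neij]; rewrite /G setD1C.
have := ksign_swap iS jS; rewrite eq_sym => /(_ neij) sw.
transitivity (ksign i S * ksign j (S :\ i) * (t i * t j * x (S :\ j :\ i))); first by ring.
by rewrite sw; ring.
Qed.

(* Contraction with c and exterior multiplication by t anticommute up to the
   scalar <c, t>. *)
Lemma skoszul_homotopy t c x S :
  skoszul t (scontract c x) S + scontract c (skoszul t x) S =
  (\sum_i c i * t i) * x S.
Proof.
(* In both composites the diagonal terms are split off: here they give the part of <c, t> over S, in
   [cd] the part over its complement. The off-diagonal terms then cancel in pairs. *)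
have dc : skoszul t (scontract c x) S = (\sum_(i in S) c i * t i) * x S +
    \sum_(i in S) \sum_(j in ~: S) ksign i S * ksign j (S :\ i) *
       (t i * c j * x (j |: S :\ i)).
  rewrite mulr_suml -big_split /=; apply: eq_bigr => i iS.
  rewrite /scontract (bigD1 i) /=; last by rewrite !inE eqxx.
  rewrite finset.setD1K // ksignD1_ge // !mulrDr; congr (_ + _).
    rewrite [RHS](_ : _ = ksign i S * ksign i S * (c i * t i * x S)); last by rewrite ksign_sqr; ring.
    by ring.
  rewrite !mulr_sumr; apply: eq_big => j; last by move=> _; ring.
  rewrite !inE negb_and negbK; case: (eqVneq j i) => [->|] /=; first by rewrite iS.
  by rewrite andbT.
have cd : scontract c (skoszul t x) S = (\sum_(j in ~: S) c j * t j) * x S +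
    \sum_(j in ~: S) \sum_(i in S) ksign j S * ksign i (j |: S) *
       (t i * c j * x (j |: S :\ i)).
  rewrite mulr_suml -big_split /=; apply: eq_bigr => j; rewrite inE => jS.
  rewrite /skoszul (bigD1 j) /=; last by rewrite !inE eqxx.
  have SE : (j |: S) :\ j = S by rewrite finset.setU1K.
  have sjE : ksign j (j |: S) = ksign j S.
    by rewrite -[in RHS]SE (@ksignD1_ge j j).
  rewrite SE sjE !mulrDr; congr (_ + _).
    rewrite [RHS](_ : _ = ksign j S * ksign j S * (c j * t j * x S)); last by rewrite ksign_sqr; ring.
    by ring.
  rewrite !mulr_sumr; apply: eq_big => i.
    rewrite !inE; case: (eqVneq i j) => [->|] /=; first by rewrite (negPf jS).
    by rewrite andbT.
  rewrite !inE => /andP[_ neij]; set y := x _; set y' := x _.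
  have -> : y = y'.
    rewrite /y /y'; congr (x _); apply/setP => l; rewrite !inE.
    by case: (eqVneq l j) => [->|] //=; rewrite eq_sym neij.
  by ring.
rewrite dc cd addrACA -mulrDl -[RHS]addr0; congr (_ + _).
  congr (_ * _); rewrite [RHS](bigID (mem S)) /=; congr (_ + _).
  by apply: eq_bigl => i; rewrite inE.
rewrite [X in _ + X]exchange_big -big_split /=.
apply: big1 => i iS; rewrite -big_split /=; apply: big1 => j; rewrite inE => jS.
rewrite -mulrDl; suff -> : ksign i S * ksign j (S :\ i) + ksign j S * ksign i (j |: S) = 0.
  by rewrite mul0r.
have neij : i != j by apply: contraNneq jS => <-.
have SE : (j |: S) :\ j = S by rewrite finset.setU1K.
have [lt|lt|/val_inj eij] := ltngtP i j; last by rewrite eij eqxx in neij.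
- rewrite (ksignD1_lt iS lt) -(ksignD1_ge (j |: S) (ltnW lt)) SE.
  by ring.
- rewrite (ksignD1_ge _ (ltnW lt)).
  have -> : ksign i (j |: S) = - ksign i S.
    by rewrite -[in RHS]SE (@ksignD1_lt i j) ?inE ?eqxx // opprK.
  by ring.
Qed.

End ScalarKoszul.

(** * Moduli and conjugates in R[i]; the real number [Re] of the modulus serves for all estimates *)

Section ComplexFacts.
Variable R : realType.
Local Notation C := R[i].
Implicit Types z w : C.

Lemma conjE z : Num.conj z = z^#.
Proof. by []. Qed.

Lemma mulcJ z : z * z^# = `|z| ^+ 2.
Proof. by rewrite -add_Re2_Im2; case: z => a b; simpc; rewrite [b * a]mulrC addNr -!expr2. Qed.

Lemma conjcM z w : (z * w)^# = z^# * w^#.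
Proof. exact: rmorphM. Qed.

Lemma conjcD z w : (z + w)^# = z^# + w^#.
Proof. exact: rmorphD. Qed.

Lemma conjc_sum (I : Type) (r : seq I) (F : I -> C) :
  (\sum_(i <- r) F i)^# = \sum_(i <- r) (F i)^#.
Proof. exact: rmorph_sum. Qed.

Lemma conjc_norm z : `|z^#| = `|z|.
Proof. by rewrite !normc_def; case: z => a b /=; rewrite sqrrN. Qed.

Lemma Re_norm_ge0 z : 0 <= Re `|z|.
Proof. by rewrite normc_def sqrtr_ge0. Qed.

Lemma real_complex_eq0 (x : R) : (x%:C == 0 :> C) = (x == 0).
Proof. by rewrite -(rmorph0 (real_complex R)) (inj_eq (@complexI _)). Qed.

Lemma real_complex_gt0 (x : R) : (0 < x%:C :> C) = (0 < x).
Proof. by rewrite -ltcR rmorph0. Qed.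

Lemma normc_Re z : `|z| = (Re `|z|)%:C.
Proof. by rewrite normc_def. Qed.

Lemma Re_le_norm z : (Re z)%:C <= `|z|.
Proof.
rewrite normc_def lecR; apply: le_trans (ler_norm _) _.
by rewrite -sqrtr_sqr ler_wsqrtr// lerDl sqr_ge0.
Qed.

Lemma normC_le_ReIm z : Re `|z| <= `|Re z| + `|Im z|.
Proof.
have -> : z = (Re z)%:C + 'i * (Im z)%:C by exact: complexE.
rewrite -lecR -normc_Re; apply: le_trans (ler_normD _ _) _.
rewrite normrM !normc_def /= !(expr0n, expr1n, addr0, add0r) sqrtr1 mul1r.
by rewrite !sqrtr_sqr -rmorphD lecR; case: z => a b /=; rewrite !(mul0r,mulr0,mul1r,subr0,addr0,add0r).
Qed.

Lemma ge0_Re z : 0 <= z -> z = (Re z)%:C.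
Proof. by move=> z0; rewrite RRe_real// ger0_real. Qed.

Lemma gt0_Re z : 0 < z -> 0 < Re z.
Proof. by rewrite ltcE => /andP[]. Qed.

Lemma ReM_real (x : R) z : Re (x%:C * z) = x * Re z.
Proof. by case: z => a b /=; rewrite mul0r subr0. Qed.

Lemma Re_norm_real (x : R) : 0 <= x -> Re `|x%:C| = x.
Proof. by move=> x0; rewrite ger0_norm// ler0c. Qed.

Lemma Re_normM z w : Re `|z * w| = Re `|z| * Re `|w|.
Proof. by rewrite normrM [`|z|]normc_Re ReM_real. Qed.

Lemma Re_normD z w : Re `|z + w| <= Re `|z| + Re `|w|.
Proof. by rewrite -lecR rmorphD /= -!normc_Re ler_normD. Qed.

Lemma Re_normX z m : Re `|z ^+ m| = Re `|z| ^+ m.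
Proof.
elim: m => [|m IH]; first by rewrite !expr0 normr1.
by rewrite !exprS Re_normM IH.
Qed.

Lemma Re_normV z : Re `|z^-1| = (Re `|z|)^-1.
Proof. by rewrite normfV [`|z|]normc_Re -fmorphV. Qed.

Lemma Re_norm_sum (I : Type) (r : seq I) (P : pred I) (h : I -> C) :
  Re `|\sum_(i <- r | P i) h i| <= \sum_(i <- r | P i) Re `|h i|.
Proof.
elim/big_rec2: _ => [|i x y _ IH]; first by rewrite normr0.
by apply: le_trans (Re_normD _ _) _; rewrite lerD2l.
Qed.

End ComplexFacts.

(** * Norm, Cauchy-Schwarz inequality and completeness in a Hilbert subspace *)

Section HilbertTheory.
Variables (R : realType) (V : lmodType R[i]) (H : set V).
Local Notation C := R[i].
Variable dot : V -> V -> C.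
Hypothesis hH : hilbert_subspace H dot.
Implicit Types (u v w : V) (a b : C).

Lemma hsD u v : H u -> H v -> H (u + v).
Proof. by move=> Hu Hv; rewrite -[u]scale1r; apply: (hs_linear hH). Qed.

Lemma hsZ a u : H u -> H (a *: u).
Proof. by move=> Hu; rewrite -[_ *: _]addr0; apply: (hs_linear hH) => //; apply: hs_zero hH. Qed.

Lemma hsN u : H u -> H (- u).
Proof. by rewrite -scaleN1r; apply: hsZ. Qed.

Lemma hsB u v : H u -> H v -> H (u - v).
Proof. by move=> Hu Hv; apply: hsD => //; apply: hsN. Qed.

Lemma hs_sum (I : Type) (r : seq I) (P : pred I) (f : I -> V) :
  (forall i, P i -> H (f i)) -> H (\sum_(i <- r | P i) f i).
Proof. by move=> Hf; elim/big_ind: _ => //; [apply: hs_zero hH|apply: hsD]. Qed.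

Lemma dotDl u v w : H u -> H v -> H w -> dot (u + v) w = dot u w + dot v w.
Proof. by move=> Hu Hv Hw; rewrite -[u in LHS]scale1r (hs_dotPl hH)// mul1r. Qed.

Lemma dot0l w : H w -> dot 0 w = 0.
Proof.
move=> Hw; have H0 := hs_zero hH; have := dotDl H0 H0 Hw.
by rewrite addr0 => /eqP; rewrite -subr_eq subrr eq_sym => /eqP.
Qed.

Lemma dotZl a u w : H u -> H w -> dot (a *: u) w = a * dot u w.
Proof.
move=> Hu Hw; rewrite -[a *: u]addr0 (hs_dotPl hH) ?dot0l ?addr0//.
exact: hs_zero hH.
Qed.

Lemma dotC u v : H u -> H v -> dot v u = (dot u v)^#.
Proof. by move=> Hu Hv; apply: (hs_dotC hH). Qed.

Lemma dotDr u v w : H u -> H v -> H w -> dot w (u + v) = dot w u + dot w v.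
Proof.
move=> Hu Hv Hw; have Huv := hsD Hu Hv.
by rewrite (dotC Huv Hw) dotDl// rmorphD/= -!dotC.
Qed.

Lemma dotZr a u w : H u -> H w -> dot w (a *: u) = a^# * dot w u.
Proof.
move=> Hu Hw; have Hau := hsZ a Hu.
by rewrite (dotC Hau Hw) dotZl// rmorphM/= -!dotC.
Qed.

Lemma dot0r w : H w -> dot w 0 = 0.
Proof. by move=> Hw; rewrite -(scale0r w) dotZr// rmorph0 mul0r. Qed.

Lemma dot_sumr (I : Type) (r : seq I) (f : I -> V) w : (forall i, H (f i)) ->
  H w -> dot w (\sum_(i <- r) f i) = \sum_(i <- r) dot w (f i).
Proof.
move=> Hf Hw; elim: r => [|i r IH]; rewrite ?big_nil ?dot0r// !big_cons.
by rewrite dotDr// ?IH//; apply: hs_sum.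
Qed.

Lemma dot_ge0 u : H u -> 0 <= dot u u.
Proof.
move=> Hu; have [->|u0] := eqVneq u 0; first by rewrite dot0l//; apply: hs_zero hH.
by apply/ltW/(hs_dot_gt0 hH).
Qed.

Definition hsnorm u : R := Num.sqrt (Re (dot u u)).

Lemma hsnorm_ge0 u : 0 <= hsnorm u. Proof. exact: sqrtr_ge0. Qed.

Lemma hsnorm_sqrE u : H u -> hsnorm u ^+ 2 = Re (dot u u).
Proof.
move=> Hu; rewrite sqr_sqrtr//; have := dot_ge0 Hu.
by rewrite lecE => /andP[].
Qed.

Lemma hsnorm_sqr u : H u -> dot u u = (hsnorm u ^+ 2)%:C.
Proof. by move=> Hu; rewrite hsnorm_sqrE// -ge0_Re// dot_ge0. Qed.

Lemma hsnorm_gt0 u : H u -> u != 0 -> 0 < hsnorm u.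
Proof. by move=> Hu u0; rewrite sqrtr_gt0 gt0_Re//; apply: (hs_dot_gt0 hH). Qed.

Lemma hsnormZ a u : H u -> hsnorm (a *: u) = Re `|a| * hsnorm u.
Proof.
move=> Hu; rewrite /hsnorm dotZl ?dotZr//; last exact: hsZ.
rewrite mulrA mulcJ normc_Re -rmorphXn/= ReM_real sqrtrM ?sqr_ge0// sqrtr_sqr ger0_norm//.
by rewrite Re_norm_ge0.
Qed.

Lemma cauchy_schwarz u v : H u -> H v -> `|dot u v| <= (hsnorm u * hsnorm v)%:C.
Proof.
move=> Hu Hv; have [->|v0] := eqVneq v 0.
  rewrite dot0r// normr0 ler0c mulr_ge0// ?hsnorm_ge0//.
have nv : (hsnorm v)%:C != 0 by rewrite real_complex_eq0 gt_eqF ?hsnorm_gt0.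
(* With this c the vector [u + c *: v] is orthogonal to v, and its squared norm is |u|^2 - |x|^2 /
   |v|^2. *)
set x := dot u v; pose c : C := - (x / dot v v).
have Hcv : H (c *: v) by exact: hsZ.
have : 0 <= dot (u + c *: v) (u + c *: v) by apply/dot_ge0/hsD.
rewrite dotDl ?dotDr ?dotZl ?dotZr//; try exact: hsD.
rewrite (dotC Hu Hv) -/x.
have cE : c^# = - (x^# / dot v v).
  by rewrite /c rmorphN rmorphM fmorphV [in RHS](dotC Hv Hv).
have -> : dot u u + c^# * x + (c * x^# + c * (c^# * dot v v)) =
  dot u u - x * x^# / dot v v.
  by rewrite cE /c; field; rewrite hsnorm_sqr// rmorphXn expf_neq0.
rewrite mulcJ subr_ge0 (hsnorm_sqr Hv) ler_pdivrMr; last first.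
  by rewrite real_complex_gt0 exprn_gt0 ?hsnorm_gt0.
rewrite (hsnorm_sqr Hu) -rmorphM -exprMn rmorphXn /= ler_pXn2r//.
by rewrite nnegrE ler0c mulr_ge0 ?hsnorm_ge0.
Qed.

Lemma hsnormD u v : H u -> H v -> hsnorm (u + v) <= hsnorm u + hsnorm v.
Proof.
move=> Hu Hv; rewrite -(@ler_pXn2r _ 2)// ?nnegrE ?addr_ge0 ?hsnorm_ge0//.
have Huv := hsD Hu Hv.
rewrite hsnorm_sqrE// dotDl ?dotDr// (dotC Hu Hv) addrA -[_ + _ + (dot u v)^#]addrA.
rewrite addcJ !raddfD/= -(hsnorm_sqrE Hu) -(hsnorm_sqrE Hv) sqrrD lerD2r lerD2l.
rewrite mulr0 subr0 -[leRHS]mulr_natl ler_pM2l//.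
by rewrite -lecR; apply: le_trans (Re_le_norm _) (cauchy_schwarz Hu Hv).
Qed.

Lemma hsnormB_sym u v : H u -> H v -> hsnorm (u - v) = hsnorm (v - u).
Proof.
move=> Hu Hv; have -> : u - v = (-1) *: (v - u) by rewrite scaleN1r opprB.
rewrite (hsnormZ _ (hsB Hv Hu)).
by rewrite normrN normr1 /= mul1r.
Qed.

Lemma hsnorm_complete (u : nat -> V) : (forall k, H (u k)) ->
  (forall e : R, 0 < e -> exists N, forall k l, (N <= k)%N -> (N <= l)%N ->
     hsnorm (u k - u l) < e) ->
  exists2 v, H v & forall e : R, 0 < e ->
    exists N, forall k, (N <= k)%N -> hsnorm (u k - v) < e.
Proof.
move=> Hu cu; have [|v Hv lv] := hs_complete hH Hu.
  move=> e e0; have [|N NP] := cu (Num.sqrt (Re e)).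
    by rewrite sqrtr_gt0 gt0_Re.
  exists N => k l Nk Nl; have := NP _ _ Nk Nl.
  rewrite (hsnorm_sqr (hsB (Hu k) (Hu l))) (ge0_Re (ltW e0)) ltcR /=.
  rewrite -[X in _ -> _ < X](@sqr_sqrtr _ (Re e)) ?ltW ?gt0_Re//.
  by rewrite ltr_pXn2r// nnegrE ?hsnorm_ge0 ?sqrtr_ge0.
exists v => // e e0; have [|N NP] := lv (e ^+ 2)%:C.
  by rewrite real_complex_gt0 exprn_gt0.
exists N => k Nk; have := NP _ Nk; rewrite (hsnorm_sqr (hsB (Hu k) Hv)) ltcR.
by rewrite ltr_pXn2r// nnegrE ?hsnorm_ge0// ltW.
Qed.

End HilbertTheory.

(** * Riesz representation of a bounded functional given by its graph *)

Section Riesz.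
Variables (R : realType) (V : lmodType R[i]) (H : set V).
Local Notation C := R[i].
Variable dot : V -> V -> C.
Hypothesis hH : hilbert_subspace H dot.
Implicit Types (u v w : V) (a b : C).
Local Notation hsnorm := (hsnorm dot).

Lemma hsnormD_sqr u v : H u -> H v ->
  hsnorm (u + v) ^+ 2 = hsnorm u ^+ 2 + hsnorm v ^+ 2 + 2 * Re (dot u v).
Proof.
move=> Hu Hv; have Huv := hsD hH Hu Hv.
rewrite !(hsnorm_sqrE hH)// (dotDl hH)// !(dotDr hH)// (dotC hH Hu Hv).
by case: (dot u u) (dot u v) (dot v v) => [a b] [c d] [e f] /=; ring.
Qed.

Lemma hsnormB_sqr u v : H u -> H v ->
  hsnorm (u - v) ^+ 2 = hsnorm u ^+ 2 + hsnorm v ^+ 2 - 2 * Re (dot u v).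
Proof.
move=> Hu Hv; have HNv := hsN hH Hv; rewrite hsnormD_sqr//.
rewrite -[- v]scaleN1r (dotZr hH)// (hsnormZ hH)// normrN normr1 /= mul1r.
by congr (_ + _); case: (dot u v) => [a b] /=; ring.
Qed.

(* The functional is only known on the graph [G]; its representing vector is
   the limit of a sequence minimising |u|^2 - 2 Re c over (u, c) in G. *)
Lemma riesz_graph (G : set (V * C)) (M : R) :
  (forall p, G p -> H p.1) -> G (0, 0) ->
  (forall a p q, G p -> G q -> G (a *: p.1 + q.1, a * p.2 + q.2)) ->
  (forall p, G p -> Re `|p.2| <= M * hsnorm p.1) ->
  exists2 v, H v & forall p, G p -> dot p.1 v = p.2.
Proof.
move=> GH G0 GL GM.
pose J (p : V * C) := hsnorm p.1 ^+ 2 - 2 * Re p.2.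
(* With N the norm of p.1, J is at least N^2 - 2 M N = (N - M)^2 - M^2. *)
have Jlb p : G p -> - M ^+ 2 <= J p.
  move=> Gp; have rl : Re p.2 <= M * hsnorm p.1.
    by apply: le_trans (GM _ Gp); rewrite -lecR -normc_Re Re_le_norm.
  rewrite /J; have := sqr_ge0 (hsnorm p.1 - M); nra.
have SI : has_inf [set J p | p in G].
  split; first by exists (J (0, 0)), (0, 0).
  by exists (- M ^+ 2) => _ [p Gp <-]; apply: Jlb.
set m := inf [set J p | p in G].
have mle p : G p -> m <= J p.
  by move=> Gp; apply: ge_inf; [case: SI|exists p].
have /choice[p pP] : forall k : nat, exists p, G p /\ J p < m + k.+1%:R^-1.
  move=> k; have k0 : 0 < (k.+1%:R^-1 : R) by rewrite invr_gt0 ltr0Sn.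
  have [_ [p Gp <-] lp] := inf_adherent k0 SI.
  by exists p.
have Gp k : G (p k) by case: (pP k).
have Jp k : J (p k) < m + k.+1%:R^-1 by case: (pP k).
have Hp k : H (p k).1 by apply/GH/Gp.
have GZ a q : G q -> G (a *: q.1, a * q.2).
  by move=> Gq; have := GL a q _ Gq G0; rewrite !addr0.
(* Parallelogram law: J at the midpoint is at least m, so near-minimisers are close to each other
   and the minimising sequence is Cauchy. *)
have par q r : G q -> G r -> hsnorm (q.1 - r.1) ^+ 2 <= 2 * J q + 2 * J r - 4 * m.
  move=> Gq Gr; have Gqr := GZ 2^-1 _ (GL 1 _ _ Gq Gr).
  have := mle _ Gqr; rewrite /J/= !scale1r !mul1r.
  have [Hq Hr] := (GH _ Gq, GH _ Gr).
  rewrite (hsnormZ hH) ?hsnormB_sqr; [|exact: Hq|exact: Hr|exact: (hsD hH)].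
  rewrite exprMn hsnormD_sqr//.
  have -> : (2^-1 : C) = (2^-1 : R)%:C by rewrite fmorphV rmorph_nat.
  rewrite normc_def /= expr0n addr0 sqrtr_sqr ger0_norm ?invr_ge0// ReM_real.
  rewrite raddfD /=; lra.
have inv_small (e : R) : 0 < e -> exists N, forall k, (N <= k)%N -> k.+1%:R^-1 < e.
  move=> e0; have [N] := ltr_add_invr e0; rewrite add0r => Ne.
  exists N => k Nk; apply: le_lt_trans Ne.
  by rewrite lef_pV2 ?posrE ?ltr0Sn// ler_nat ltnS.
have [||v Hv lv] := hsnorm_complete hH (u := fun k => (p k).1); first exact: Hp.
  move=> e e0; have [|N NP] := inv_small (e ^+ 2 / 4); first by rewrite divr_gt0 ?exprn_gt0.
  exists N => k l Nk Nl; rewrite -(@ltr_pXn2r _ 2)// ?nnegrE ?hsnorm_ge0// ?ltW//.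
  apply: le_lt_trans (par _ _ (Gp k) (Gp l)) _.
  have := Jp k; have := Jp l; have := NP _ Nk; have := NP _ Nl.
  move: (J _) (J _) (k.+1%:R^-1) (l.+1%:R^-1) (e ^+ 2) => *; lra.
exists v => // -[g c] Gg /=; have Hg : H g := GH _ Gg.
(* First variation: moving from [p k] along g lowers J by less than 1/(k+1). The step - conj(d) / N2
   turns this into a bound on the defect d; the summand 1 keeps N2 positive when g = 0. *)
set N2 := 1 + hsnorm g ^+ 2.
have N2_gt0 : 0 < N2 by rewrite ltr_pwDl// sqr_ge0.
have var k : Re `|dot g (p k).1 - c| ^+ 2 <= N2 * k.+1%:R^-1.
  set d := dot g (p k).1 - c.
  have := mle _ (GL (- (N2^-1)%:C * d^#) _ _ Gg (Gp k)).
  have := Jp k; rewrite /J/=.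
  set t := _ * d^#; have Htg : H (t *: g) by apply: (hsZ hH).
  rewrite hsnormD_sqr// (hsnormZ hH)// (dotZl hH)// exprMn.
  have -> : Re (t * dot g (p k).1) = Re (t * c) - N2^-1 * Re `|d| ^+ 2.
    have -> : dot g (p k).1 = c + d by rewrite /d addrC subrK.
    rewrite mulrDr raddfD/=; congr (_ + _).
    have -> : t * d = - (N2^-1 * Re `|d| ^+ 2)%:C.
      rewrite /t -mulrA [d^# * d]mulrC mulcJ normc_Re -rmorphXn /= mulNr.
      by rewrite -rmorphM.
    by rewrite raddfN.
  have -> : Re `|t| = N2^-1 * Re `|d|.
    by rewrite /t Re_normM normrN conjc_norm Re_norm_real ?invr_ge0 ?ltW.
  rewrite raddfD/= exprMn => h1 h2.
  set D := Re `|d| ^+ 2 in h1 h2 *.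
  have h3 : N2^-1 ^+ 2 * D * hsnorm g ^+ 2 = N2^-1 * D - N2^-1 ^+ 2 * D.
    have -> : hsnorm g ^+ 2 = N2 - 1 by rewrite /N2 addrC addKr.
    by field; rewrite gt_eqF.
  have D0 : 0 <= N2^-1 ^+ 2 * D by rewrite mulr_ge0 ?sqr_ge0.
  have : N2^-1 * D <= k.+1%:R^-1.
    rewrite h3 in h2; move: h1 h2 D0; move: (k.+1%:R^-1) (N2^-1 ^+ 2 * D) (N2^-1 * D).
    move: (hsnorm (p k).1 ^+ 2) (Re (p k).2) (Re (t * c)) => *; lra.
  by rewrite mulrC ler_pdivrMr// mulrC.
apply/eqP; rewrite -subr_eq0 -normr_le0 normc_Re lecR leNgt; apply/negP => h.
set eta := Re _ in h.
have [|N1 N1P] := inv_small ((eta / 2) ^+ 2 / N2).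
  by rewrite divr_gt0// exprn_gt0// divr_gt0.
have [|N3 N3P] := lv (eta / 2 / N2); first by rewrite !divr_gt0.
set k := maxn N1 N3.
have h1 : Re `|dot g (p k).1 - c| < eta / 2.
  rewrite -(@ltr_pXn2r _ 2)// ?nnegrE ?Re_norm_ge0 ?divr_ge0 ?ltW//.
  apply: le_lt_trans (var k) _; rewrite mulrC -ltr_pdivlMr//.
  by apply: N1P; rewrite leq_maxl.
have h2 : Re `|dot g v - dot g (p k).1| < eta / 2.
  have Hvp := hsB hH Hv (Hp k).
  have -> : dot g v - dot g (p k).1 = dot g (v - (p k).1).
    by rewrite (dotDr hH)//; [rewrite -scaleN1r (dotZr hH)// rmorphN1 mulN1r|apply: (hsN hH)].
  have := cauchy_schwarz hH Hg Hvp; rewrite normc_Re lecR => cs.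
  apply: le_lt_trans cs _; rewrite (hsnormB_sym hH)//.
  have := N3P k (leq_maxr _ _); set x := hsnorm (_ - _) => xl.
  have x0 : 0 <= x by exact: hsnorm_ge0.
  apply: (@le_lt_trans _ _ (N2 * x)).
    by rewrite ler_wpM2r// /N2; have := sqr_ge0 (hsnorm g - 1); nra.
  by rewrite mulrC -ltr_pdivlMr.
have : eta <= Re `|dot g v - dot g (p k).1| + Re `|dot g (p k).1 - c|.
  rewrite -lecR rmorphD /= -!normc_Re.
  have -> : dot g v - c = (dot g v - dot g (p k).1) + (dot g (p k).1 - c) by rewrite addrA subrK.
  exact: ler_normD.
lra.
Qed.

End Riesz.

(** * The gliding hump argument *)

Section GlidingHump.
Variables (R : realType) (V : lmodType R[i]) (H : set V).
Local Notation C := R[i].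
Variable dot : V -> V -> C.
Hypothesis hH : hilbert_subspace H dot.
Local Notation hsnorm := (hsnorm dot).
Local Notation r := (3^-1 : R).

Let r_gt0 k : 0 < r ^+ k. Proof. by rewrite exprn_gt0// invr_gt0. Qed.

(** For a unit vector [e k], the pairings of the two candidates with [e k] differ by 2 r^k, so the
    one selected pairs with [e k] to at least r^k in modulus. *)
Definition hump_step (e : nat -> V) (k : nat) (f : V) : V :=
  if r ^+ k <= Re `|dot (f + (r ^+ k)%:C *: e k) (e k)|
  then f + (r ^+ k)%:C *: e k else f - (r ^+ k)%:C *: e k.

(** The limit of the successive humps. As r = 1/3, all steps after the k-th have total norm at most
    (3/2) r^(k+1) = r^k / 2, so half of the pairing secured at step k survives. *)
Lemma hump_unit (e : nat -> V) : (forall k, H (e k)) -> (forall k, hsnorm (e k) = 1) ->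
  exists2 v, H v & forall k, r ^+ k / 2 <= Re `|dot v (e k)|.
Proof.
move=> He e1; pose f k := iteri k (hump_step e) 0.
have Hre k : H ((r ^+ k)%:C *: e k) by apply: (hsZ hH).
have Hf k : H (f k).
  elim: k => [|k IH]; first exact: hs_zero hH.
  rewrite /f /= -/(f k) /hump_step; case: ifP => _; first exact: (hsD hH).
  exact: (hsB hH).
have nre k : hsnorm ((r ^+ k)%:C *: e k) = r ^+ k.
  by rewrite (hsnormZ hH)// e1 mulr1 normc_def/= expr0n addr0 sqrtr_sqr ger0_norm// ltW.
have fS k : hsnorm (f k.+1 - f k) = r ^+ k.
  rewrite /f /= -/(f k) /hump_step; case: ifP => _; rewrite addrC addKr ?nre//.
  by rewrite -scaleN1r (hsnormZ hH)// normrN normr1 /= mul1r nre.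
have dee k : dot (e k) (e k) = 1 by rewrite (hsnorm_sqr hH)// e1 expr1n.
have big k : r ^+ k <= Re `|dot (f k.+1) (e k)|.
  have -> : f k.+1 = hump_step e k (f k) by [].
  rewrite /hump_step; case: ifP => // /negbT; rewrite -ltNge.
  rewrite (dotDl hH)// (dotDl hH)//; last exact: (hsN hH).
  rewrite -scaleN1r !(dotZl hH)// dee mulr1 mulN1r.
  set a := dot _ _ => lt.
  have : Re `|(2 * r ^+ k)%:C| <= Re `|a + (r ^+ k)%:C| + Re `|a - (r ^+ k)%:C|.
    have -> : (2 * r ^+ k)%:C = (a + (r ^+ k)%:C) - (a - (r ^+ k)%:C).
      by rewrite rmorphM /= rmorph_nat; ring.
    by rewrite -lecR rmorphD /= -!normc_Re -[X in _ <= _ + X]normrN ler_normD.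
  rewrite Re_norm_real; last by rewrite mulr_ge0// ltW.
  lra.
have tail k j : hsnorm (f (k + j)%N - f k) <= 3 / 2 * (r ^+ k - r ^+ (k + j)).
  elim: j => [|j IH].
    rewrite addn0 !subrr mulr0 /hsnorm (dot0l hH) /= ?sqrtr0//; exact: hs_zero hH.
  rewrite addnS; have -> : f (k + j).+1 - f k = (f (k + j).+1 - f (k + j)%N) + (f (k + j)%N - f k).
    by rewrite addrA subrK.
  have Hj := Hf (k + j)%N; have HSj := Hf (k + j).+1.
  have := hsnormD hH (hsB hH HSj Hj) (hsB hH Hj (Hf k)).
  rewrite fS exprS => ?; lra.
have tail_le k l : (k <= l)%N -> hsnorm (f l - f k) <= 3 / 2 * r ^+ k.
  move=> kl; have := tail k (l - k)%N; rewrite subnKC// => /le_trans; apply.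
  have := r_gt0 l; lra.
have small (x : R) : 0 < x -> exists k, 3 * r ^+ k < x.
  move=> x0; have [k] := ltr_add_invr (divr_gt0 x0 (ltr0Sn R 2)).
  rewrite add0r => kx; exists k; rewrite mulrC -ltr_pdivlMr//.
  apply: le_lt_trans kx; rewrite exprVn lef_pV2 ?posrE ?ltr0Sn ?exprn_gt0//.
  by rewrite -natrX ler_nat ltn_expl.
have [|v Hv lv] := hsnorm_complete hH Hf.
  move=> x x0; have [N NP] := small _ x0; exists N => k l Nk Nl.
  have -> : f k - f l = (f k - f N) + (f N - f l) by rewrite addrA subrK.
  have := hsnormD hH (hsB hH (Hf k) (Hf N)) (hsB hH (Hf N) (Hf l)).
  rewrite (hsnormB_sym hH (Hf N) (Hf l)).
  have := tail_le _ _ Nk; have := tail_le _ _ Nl; lra.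
exists v => // k.
have vk : hsnorm (f k.+1 - v) <= 3 / 2 * r ^+ k.+1.
  rewrite leNgt; apply/negP => lt.
  have [|N NP] := lv (hsnorm (f k.+1 - v) - 3 / 2 * r ^+ k.+1); first by rewrite subr_gt0.
  have := NP _ (leq_maxl N k.+1); have := tail_le _ _ (leq_maxr N k.+1).
  set l := maxn _ _; rewrite (hsnormB_sym hH (Hf l) (Hf k.+1)) => h1 h2.
  have : hsnorm (f k.+1 - v) <= hsnorm (f k.+1 - f l) + hsnorm (f l - v).
    have -> : f k.+1 - v = (f k.+1 - f l) + (f l - v) by rewrite addrA subrK.
    by apply: (hsnormD hH); apply: (hsB hH).
  lra.
have Hfv := hsB hH (Hf k.+1) Hv.
have := cauchy_schwarz hH Hfv (He k); rewrite normc_Re lecR e1 mulr1 => h1.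
have h2 : Re `|dot (f k.+1) (e k)| <= Re `|dot v (e k)| + Re `|dot (f k.+1 - v) (e k)|.
  have {1}-> : f k.+1 = v + (f k.+1 - v) by rewrite addrC subrK.
  by rewrite (dotDl hH)// -lecR rmorphD /= -!normc_Re ler_normD.
have := big k; rewrite exprS in vk; lra.
Qed.

(** The humps are the normalised [g (m k)], along indices with delta < r^(2k): the limit pairs with
    them to at least r^k / 2, which exceeds B r^(2k) for large k. A single v serves all B, so B may
    later depend on v. *)
Lemma gliding_hump (g : nat -> V) (delta : nat -> R) :
  (forall m, H (g m)) -> (forall m, g m != 0) -> (forall m, 0 <= delta m) ->
  (forall x, 0 < x -> exists m, delta m < x) ->
  exists2 v, H v &
    forall B : R, exists m, B * delta m * hsnorm (g m) < Re `|dot v (g m)|.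
Proof.
move=> Hg g0 d0 ds.
have /choice[m mP] : forall k : nat, exists m, delta m < r ^+ k * r ^+ k.
  by move=> k; apply: ds; rewrite mulr_gt0.
have n0 k : 0 < hsnorm (g (m k)) by apply: (hsnorm_gt0 hH).
pose e k := ((hsnorm (g (m k)))^-1)%:C *: g (m k).
have He k : H (e k) by apply: (hsZ hH).
have e1 k : hsnorm (e k) = 1.
  rewrite (hsnormZ hH)// normc_def/= expr0n addr0 sqrtr_sqr ger0_norm ?invr_ge0 ?ltW//.
  by rewrite mulVf// gt_eqF.
have [v Hv vP] := hump_unit He e1; exists v => // B.
have [k kP] : exists k : nat, 2 * `|B| * r ^+ k < 1.
  have h0 : 0 < (2 * `|B| + 1)^-1 by rewrite invr_gt0 ltr_wpDl// mulr_ge0.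
  have [k] := ltr_add_invr h0; rewrite add0r => h; exists k; have B0 : 0 <= `|B| by [].
  have B1 : 0 < 2 * `|B| + 1 by lra.
  apply: (@le_lt_trans _ _ (2 * `|B| * (2 * `|B| + 1)^-1)).
    rewrite ler_wpM2l ?mulr_ge0//; apply/ltW/(le_lt_trans _ h).
    rewrite exprVn lef_pV2 ?posrE ?ltr0Sn ?exprn_gt0//.
    by rewrite -natrX ler_nat ltn_expl.
  by rewrite ltr_pdivrMr// mul1r ltrDl.
exists (m k).
have ge : g (m k) = (hsnorm (g (m k)))%:C *: e k.
  by rewrite scalerA -rmorphM mulfV ?gt_eqF// scale1r.
rewrite [X in dot v X]ge (dotZr hH)// conjc_real Re_normM Re_norm_real ?ltW//.
rewrite [_ * Re _]mulrC ltr_pM2r//.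
apply: lt_le_trans (vP k); have := mP k; have := r_gt0 k; have := d0 (m k).
have := ler_norm B; move: kP; set x := r ^+ k; set b := `|B|; set d := delta _.
move=> h1 h2 h3 h4 h5.
have b0 : 0 <= b by exact: normr_ge0.
have : B * d <= b * (x * x).
  by apply: (@le_trans _ _ (b * d)); [rewrite ler_wpM2r|rewrite ler_wpM2l// ltW].
have : 2 * b * x * x < 1 * x by rewrite ltr_pM2r.
lra.
Qed.

End GlidingHump.

(** * Derivatives of complex-valued functions of a real variable *)

Section RealPathDerivative.
Variable R : realType.
Local Notation C := R[i].
Implicit Types (f g : R -> R) (F G : R -> C) (s : R).

Lemma is_derive_funD f g s a b : is_derive s 1 f a -> is_derive s 1 g b ->
  is_derive s 1 (fun x => f x + g x) (a + b).
Proof. exact: is_deriveD. Qed.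

Lemma is_derive_funB f g s a b : is_derive s 1 f a -> is_derive s 1 g b ->
  is_derive s 1 (fun x => f x - g x) (a - b).
Proof. exact: is_deriveB. Qed.

Lemma is_derive_funM f g s a b : is_derive s 1 f a -> is_derive s 1 g b ->
  is_derive s 1 (fun x => f x * g x) (a * g s + f s * b).
Proof.
move=> fa gb; apply: (is_derive_eq (is_deriveM fa gb)).
by rewrite addrC [g s *: a]mulrC.
Qed.

Definition is_cderive s F (D : C) : Prop :=
  is_derive s 1 (fun x => Re (F x)) (Re D) /\
  is_derive s 1 (fun x => Im (F x)) (Im D).

Lemma is_cderive_cst s (c : C) : is_cderive s (fun=> c) 0.
Proof. by split; exact: is_derive_cst. Qed.

Lemma is_cderive_id s : is_cderive s (fun x => x%:C) 1.
Proof. by split; [exact: is_derive_id|exact: is_derive_cst]. Qed.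

Lemma is_cderiveD s F G a b : is_cderive s F a -> is_cderive s G b ->
  is_cderive s (fun x => F x + G x) (a + b).
Proof.
move=> [F1 F2] [G1 G2]; split.
  rewrite raddfD/= (_ : (fun x => _) = (fun x => Re (F x) + Re (G x))).
    exact: is_derive_funD.
  by apply/funext => x; rewrite raddfD.
rewrite raddfD/= (_ : (fun x => _) = (fun x => Im (F x) + Im (G x))).
  exact: is_derive_funD.
by apply/funext => x; rewrite raddfD.
Qed.

Lemma is_cderiveM s F G a b : is_cderive s F a -> is_cderive s G b ->
  is_cderive s (fun x => F x * G x) (a * G s + F s * b).
Proof.
move=> [F1 F2] [G1 G2]; split.
  rewrite (_ : (fun x => _) = (fun x => Re (F x) * Re (G x) - Im (F x) * Im (G x))).
    apply: is_derive_eq (is_derive_funB (is_derive_funM F1 G1) (is_derive_funM F2 G2)) _.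
    by case: a F1 F2 b G1 G2 (F s) (G s) => [a1 a2] _ _ [b1 b2] _ _ [x y] [z t] /=; ring.
  by apply/funext => x; case: (F x) (G x) => [? ?] [].
rewrite (_ : (fun x => _) = (fun x => Re (F x) * Im (G x) + Im (F x) * Re (G x))).
  apply: is_derive_eq (is_derive_funD (is_derive_funM F1 G2) (is_derive_funM F2 G1)) _.
  by case: a F1 F2 b G1 G2 (F s) (G s) => [a1 a2] _ _ [b1 b2] _ _ [x y] [z t] /=; ring.
by apply/funext => x; case: (F x) (G x) => [? ?] [].
Qed.

Lemma is_cderive_sum s (n : nat) (F : nat -> R -> C) (d : nat -> C) :
  (forall m, is_cderive s (F m) (d m)) ->
  is_cderive s (fun x => \sum_(m < n) F m x) (\sum_(m < n) d m).
Proof.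
move=> Fd; elim: n => [|n IH].
  rewrite (_ : (fun x => _) = fun=> 0); last by apply/funext => x; rewrite big_ord0.
  by rewrite big_ord0; exact: is_cderive_cst.
rewrite (_ : (fun x => _) = fun x => \sum_(m < n) F m x + F n x).
  by rewrite big_ord_recr; apply: is_cderiveD.
by apply/funext => x; rewrite big_ord_recr.
Qed.

Lemma is_cderiveX s m : is_cderive s (fun x => x%:C ^+ m) (m%:R * s%:C ^+ m.-1).
Proof.
elim: m => [|m IH].
  by rewrite mul0r; exact: is_cderive_cst.
rewrite (_ : (fun x => _) = fun x => x%:C * x%:C ^+ m); last first.
  by apply/funext => x; rewrite exprS.
rewrite [X in is_cderive _ _ X](_ : _ = 1 * s%:C ^+ m + s%:C * (m%:R * s%:C ^+ m.-1)).
  exact: (is_cderiveM (is_cderive_id s) IH).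
case: m {IH} => [|m]; first by rewrite mul0r mulr0 addr0.
have -> : (m.+2%:R : C) = m.+1%:R + 1 by rewrite -natr1.
by move: (m.+1%:R : C) => k; rewrite [_.+2.-1]/= [_.+1.-1]/= exprS; ring.
Qed.

(** The mean value theorem is applied to real and imaginary parts separately, whence the factor
    2. *)
Lemma cderive_mvt F (D : R -> C) (B : R) :
  (forall s, 0 <= s <= 1 -> is_cderive s F (D s)) ->
  (forall s, 0 <= s <= 1 -> Re `|D s| <= B) ->
  Re `|F 1 - F 0| <= 2 * B.
Proof.
move=> FD DB.
have mvt (h dh : R -> R) : (forall s, 0 <= s <= 1 -> is_derive s 1 h (dh s)) ->
    (forall s, 0 <= s <= 1 -> `|dh s| <= B) -> `|h 1 - h 0| <= B.
  move=> hd hB; have sub s : s \in `]0, 1[ -> 0 <= s <= 1.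
    by rewrite in_itv /= => /andP[/ltW -> /ltW ->].
  have [||c c01 ->] := @MVT R h dh 0 1 ltr01.
  - by move=> s /sub; apply: hd.
  - apply: derivable_within_continuous => s; rewrite in_itv /= => s01.
    by have [] := hd s s01.
  by rewrite subr0 mulr1 hB// sub.
have nRI (z : C) : `|Re z| <= Re `|z| /\ `|Im z| <= Re `|z|.
  by rewrite normc_def /=; split; rewrite -sqrtr_sqr ler_wsqrtr// ?lerDl ?lerDr sqr_ge0.
apply: le_trans (normC_le_ReIm _) _; rewrite !raddfB /= mulr2n mulrDl mul1r lerD//.
  apply: (mvt (fun x => Re (F x)) (fun x => Re (D x))) => s s01; first by case: (FD s s01).
  by apply: le_trans (DB s s01); case: (nRI (D s)).
apply: (mvt (fun x => Im (F x)) (fun x => Im (D x))) => s s01; first by case: (FD s s01).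
by apply: le_trans (DB s s01); case: (nRI (D s)).
Qed.

End RealPathDerivative.

(** * Growth of the coefficients of (1 - t)^(-l) *)

Section BinomialCoefficients.
Variables (R : realType) (l : R).
Hypothesis l_gt0 : 0 < l.

(** The coefficient l (l+1) ... (l+m-1) / m! of t^m in (1 - t)^(-l). *)
Definition bcoef (m : nat) : R := \prod_(k < m) ((l + k%:R) / k.+1%:R).

Lemma bcoef0 : bcoef 0 = 1.
Proof. exact: big_ord0. Qed.

Lemma bcoefS m : m.+1%:R * bcoef m.+1 = (l + m%:R) * bcoef m.
Proof.
rewrite /bcoef big_ord_recr /= mulrCA [m.+1%:R * _]mulrC divfK ?pnatr_eq0//.
by rewrite mulrC.
Qed.

Lemma bcoef_gt0 m : 0 < bcoef m.
Proof. by apply: prodr_gt0 => k _; rewrite divr_gt0 ?ltr0Sn// ltr_pwDl. Qed.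

(** The finitely many terms before J only enlarge the constant: the induction on J drops the first
    term of the sequence. *)
Lemma eventually_nondecreasing_bound (b : nat -> R) (J : nat) :
  (forall j, 0 < b j) -> (forall j, (J <= j)%N -> b j <= b j.+1) ->
  exists2 K, 0 < K & forall j m, b j <= K * b (j + m)%N.
Proof.
elim: J b => [|J IH] b b0 bJ.
  exists 1 => // j m; rewrite mul1r; elim: m => [|m]; first by rewrite addn0.
  by move=> /le_trans; apply; rewrite addnS bJ.
have [||K K0 KP] := IH (fun j => b j.+1).
- by move=> j; apply: b0.
- by move=> j Jj; apply: bJ.
have q0 : 0 < b 0%N / b 1%N by rewrite divr_gt0.
(* The summands serve, in turn, j = m = 0, then j > 0, then j = 0 < m, where b 0 is compared with b
   1 first. *)
exists (1 + K + b 0%N / b 1%N * K) => [|[|j] m].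
- by rewrite !addr_gt0// mulr_gt0.
- case: m => [|m]; first by have := mulr_gt0 q0 K0; rewrite addn0 => ?; rewrite ler_peMl ?(ltW (b0 _))//; lra.
  rewrite !mulrDl -[leLHS]add0r lerD//.
    by rewrite -mulrDl mulr_ge0 ?addr_ge0 ?ltW.
  by have := ler_wpM2l (ltW q0) (KP 0%N m); rewrite divfK ?gt_eqF// mulrA.
- apply: le_trans (KP j m) _; rewrite addSn ler_wpM2r ?(ltW (b0 _))//.
  by have := mulr_gt0 q0 K0; lra.
Qed.

Lemma archi_bound (x y : R) : 0 < y -> exists J : nat, forall j, (J <= j)%N -> x <= y * j%:R.
Proof.
move=> y0; exists (Num.trunc (`|x| / y)).+1 => j Jj.
rewrite mulrC -ler_pdivrMr//; apply: le_trans (_ : `|x| / y <= _).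
  by rewrite ler_pM2r ?invr_gt0// ler_norm.
apply/ltW; apply: lt_le_trans (truncnS_gt _) _; first by rewrite ler_nat.
Qed.

(** The ratio of consecutive coefficients is (l + j) / (j + 1), which tends to 1, so
    [bcoef j * r ^+ j] is eventually nondecreasing. *)
Lemma bcoef_shift_bound (r : R) : 1 < r ->
  exists2 K, 0 < K & forall j m, bcoef j <= K * r ^+ m * bcoef (j + m)%N.
Proof.
move=> r1; have r0 : 0 < r by apply: lt_trans r1.
have [|J JP] := @archi_bound 1 (r - 1); first by rewrite subr_gt0.
have [||K K0 KP] := @eventually_nondecreasing_bound (fun j => bcoef j * r ^+ j) J.
- by move=> j; rewrite mulr_gt0 ?bcoef_gt0 ?exprn_gt0.
- move=> j Jj; rewrite exprS mulrA ler_pM2r ?exprn_gt0//.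
  have j0 : 0 < (j.+1%:R : R) by rewrite ltr0Sn.
  rewrite -(ler_pM2l j0) mulrA bcoefS -mulrA [bcoef j * r]mulrC mulrA ler_pM2r ?bcoef_gt0//.
  have := JP _ Jj; rewrite -natr1 mulrBl mul1r => h.
  by have := mulr_gt0 l_gt0 r0; nra.
exists K => // j m; rewrite -(@ler_pM2r _ (r ^+ j)) ?exprn_gt0//.
by have := KP j m; rewrite exprD; congr (_ <= _); ring.
Qed.

(** For the same reason r^j / ((j+1) [bcoef j]) is eventually nondecreasing; its value at 0 is
    compared with the one at m. *)
Lemma bcoef_growth (r : R) : 1 < r ->
  exists2 K, 0 < K & forall m, m.+1%:R * bcoef m <= K * r ^+ m.
Proof.
move=> r1; have r0 : 0 < r by apply: lt_trans r1.
have [|J JP] := @archi_bound (2 * l) (r - 1); first by rewrite subr_gt0.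
have ab0 j : 0 < j.+1%:R * bcoef j by rewrite mulr_gt0 ?ltr0Sn ?bcoef_gt0.
have [||K K0 KP] := @eventually_nondecreasing_bound (fun j => r ^+ j / (j.+1%:R * bcoef j)) J.
- by move=> j; rewrite divr_gt0 ?exprn_gt0.
- move=> j Jj; rewrite ler_pdivrMr// mulrAC ler_pdivlMr// exprSr -!mulrA.
  rewrite ler_pM2l ?exprn_gt0//.
  have j0 : 0 < (j.+1%:R : R) by rewrite ltr0Sn.
  have -> : j.+2%:R * bcoef j.+1 = j.+2%:R * ((l + j%:R) * bcoef j) / j.+1%:R.
    by rewrite -bcoefS; field; rewrite gt_eqF.
  rewrite ler_pdivrMr// !mulrA [leRHS]mulrAC ler_pM2r ?bcoef_gt0//.
  have := JP _ (leqW Jj); rewrite -[j.+2]addn1 natrD.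
  have -> : (j%:R : R) = j.+1%:R - 1 by rewrite -natr1 addrK.
  have : (1 : R) <= j.+1%:R by rewrite ler1n.
  move: (j.+1%:R : R) => k k1 h.
  have : 2 * l * k <= (r - 1) * k * k by rewrite ler_pM2r//; lra.
  have : l <= l * k by rewrite ler_peMr// ltW.
  by move=> h1 h2; nra.
exists (K * (1 * bcoef 0%N)); first by rewrite mulr_gt0 ?mul1r ?bcoef_gt0.
move=> m; have := KP 0%N m; rewrite add0n expr0 ler_pdivrMr ?ab0//.
rewrite mulrC !mulrA ler_pdivlMr ?ab0// => h.
by move: h; congr (_ <= _); ring.
Qed.

End BinomialCoefficients.

(** * The principal branch of z^a on the right half-plane *)

Section RightHalfPlanePower.
Variable R : realType.
Local Notation C := R[i].
Implicit Types (z : C) (a : R).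

(** The modulus becomes a power of |z|^2, a polynomial in the coordinates, which is convenient to
    differentiate. *)
Lemma rhp_powE z a : rhp_pow z a =
  Complex ((Re z ^+ 2 + Im z ^+ 2) `^ (a / 2) * cos (a * atan (Im z / Re z)))
          ((Re z ^+ 2 + Im z ^+ 2) `^ (a / 2) * sin (a * atan (Im z / Re z))).
Proof.
case: z => x y /=; rewrite -powR12_sqrt ?addr_ge0 ?sqr_ge0// -powRrM.
by rewrite [2^-1 * a]mulrC.
Qed.

Lemma rhp_pow1 a : rhp_pow 1 a = 1.
Proof. by rewrite /rhp_pow /= expr1n expr0n addr0 sqrtr1 powR1 mul0r atan0 mulr0 cos0 sin0 mulr1 mulr0. Qed.

Lemma norm_rhp_pow z a : Re `|rhp_pow z a| = Re `|z| `^ a.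
Proof.
rewrite rhp_powE !normc_def /= !exprMn -mulrDr cos2Dsin2 mulr1 sqrtr_sqr.
rewrite ger0_norm ?powR_ge0// -powR12_sqrt ?addr_ge0 ?sqr_ge0// -powRrM.
by rewrite [2^-1 * a]mulrC.
Qed.

Lemma rhp_powN_mul z a : 0 < Re z -> rhp_pow z (- a) * rhp_pow z a = 1.
Proof.
move=> z0; rewrite !rhp_powE !mulNr cosN sinN powRN.
set q := _ `^ _; set c := cos _; set s := sin _.
have q0 : q != 0 by rewrite gt_eqF// powR_gt0// ltr_pwDl ?sqr_ge0// exprn_gt0.
have cs : c ^+ 2 + s ^+ 2 = 1 by rewrite cos2Dsin2.
apply/eqP; rewrite eq_complex /=; apply/andP; split; apply/eqP; last by ring.
by transitivity (c ^+ 2 + s ^+ 2) => //; field.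
Qed.

(** The chain rule, with F^(a-1) written as F^a / F. The modulus contributes the real part of D / F
    and the arctangent its imaginary part. *)
Lemma is_cderive_rhp_pow (s : R) (F : R -> C) (D : C) a :
  0 < Re (F s) -> is_cderive s F D ->
  is_cderive s (fun x => rhp_pow (F x) a) (a%:C * D / F s * rhp_pow (F s) a).
Proof.
move=> F0 [F1 F2].
pose X x := Re (F x); pose Y x := Im (F x).
pose Q x := X x * X x + Y x * Y x.
have X0 : 0 < X s by [].
have Q0 : 0 < Q s by rewrite ltr_pwDl ?mulr_gt0// -expr2 sqr_ge0.
have dQ : is_derive s 1 Q (2 * (X s * Re D + Y s * Im D)).
  apply: is_derive_eq (is_derive_funD (is_derive_funM F1 F1) (is_derive_funM F2 F2)) _.
  by rewrite /X /Y; ring.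
pose P x := Q x `^ (a / 2).
have dP : is_derive s 1 P (a * P s / Q s * (X s * Re D + Y s * Im D)).
  apply: is_derive_eq (is_derive1_comp (is_derive1_powR (a / 2) Q0) dQ) _.
  rewrite powRB ?(gt_eqF Q0) ?implybT// powRr1 ?ltW// -/(P s).
  by field; rewrite gt_eqF.
have dV := is_deriveV (lt0r_neq0 X0) F1.
have dq : is_derive s 1 (fun x => Y x * (X x)^-1) (Im D / X s - Y s * Re D / X s ^+ 2).
  apply: is_derive_eq (is_derive_funM F2 dV) _.
  rewrite /GRing.scale /= -/(X s) -/(Y s).
  by field; rewrite gt_eqF.
pose T x := atan (Y x * (X x)^-1).
have dT : is_derive s 1 (fun x => a * T x) (a * ((X s * Im D - Y s * Re D) / Q s)).
  have h := @is_derive1_comp _ atan (fun x => Y x * (X x)^-1) s _ _ (is_derive1_atan _) dq.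
  apply: is_derive_eq (is_derive_funM (is_derive_cst a s 1) h) _.
  rewrite /= mul0r add0r; congr (_ * _); rewrite /Q.
  have : X s * X s + Y s * Y s != 0 by rewrite gt_eqF.
  move: (lt0r_neq0 X0); move: (X s) (Y s) => x y x0 xy0.
  by field; rewrite x0 /= xy0.
have dcos := @is_derive1_comp _ cos (fun x => a * T x) s _ _ (is_derive_cos _) dT.
have dsin := @is_derive1_comp _ sin (fun x => a * T x) s _ _ (is_derive_sin _) dT.
have FE : F s = X s +i* Y s by rewrite /X /Y; case: (F s).
have DE : D = Re D +i* Im D by case: (D).
have coef : a%:C * D / F s =
    (a * ((X s * Re D + Y s * Im D) / Q s)) +i* (a * ((X s * Im D - Y s * Re D) / Q s)).
  have Fn0 : F s != 0 by rewrite FE eq_complex /= (gt_eqF X0).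
  apply: (mulIf Fn0); rewrite divfK// FE DE /=.
  apply/eqP; rewrite eq_complex /= /Q.
  have Q1 : X s * X s + Y s * Y s != 0 by rewrite gt_eqF.
  by apply/andP; split; apply/eqP; field.
have rE x : rhp_pow (F x) a = (P x * cos (a * T x)) +i* (P x * sin (a * T x)).
  by rewrite rhp_powE /P /T /Q /X /Y !expr2.
split.
  rewrite (_ : (fun x => _) = fun x => P x * cos (a * T x)); last first.
    by apply/funext => x; rewrite rE.
  apply: is_derive_eq (is_derive_funM dP dcos) _.
  by rewrite coef rE /=; ring.
rewrite (_ : (fun x => _) = fun x => P x * sin (a * T x)); last first.
  by apply/funext => x; rewrite rE.
apply: is_derive_eq (is_derive_funM dP dsin) _.
by rewrite coef rE /=; ring.
Qed.

End RightHalfPlanePower.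

(** * Geometric convergence of the binomial series *)

Section BinomialSeries.
Variables (R : realType) (l : R).
Hypothesis l_gt0 : 0 < l.
Local Notation C := R[i].
Local Notation bcoef := (bcoef l).

Definition bpart (t : C) (M : nat) : C := \sum_(m < M) (bcoef m)%:C * t ^+ m.

(** The derivative in s of [bpart (s%:C * t) M]. *)
Let sdiff (t : C) (M : nat) (s : R) : C :=
  \sum_(m < M) (bcoef m)%:C * t ^+ m * (m%:R * s%:C ^+ m.-1).

(* Partial sums of (1 - x)^(-l) satisfy the differential equation
   (1 - x) y' = l y up to their last term. *)
Let sdiffE t M s : (1 - s%:C * t) * sdiff t M s =
  l%:C * t * bpart (s%:C * t) M - M%:R * (bcoef M)%:C * t ^+ M * s%:C ^+ M.-1.
Proof.
elim: M => [|M IH].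
  by rewrite /sdiff /bpart !big_ord0 !mulr0 !mul0r subr0.
rewrite /sdiff /bpart !big_ord_recr /= -/(sdiff t M s) -/(bpart _ M).
rewrite mulrDr IH.
have -> : (M.+1%:R : C) * (bcoef M.+1)%:C = (l%:C + M%:R) * (bcoef M)%:C.
  by rewrite -!(rmorph_nat (real_complex R)) -rmorphM bcoefS rmorphM rmorphD.
case: M {IH} => [|M]; first by rewrite /= !expr0 expr1; ring.
by rewrite /= exprMn !exprS; ring.
Qed.

(** By [sdiffE], the product of the partial sum at s t with (1 - s t)^l has a derivative in s made
    of the last term alone. The mean value bound on [0, 1] then compares its value at 1 with its
    value 1 at s = 0. *)
Lemma binomial_series (t : C) : Re `|t| < 1 ->
  exists K rho : R, [/\ 0 <= K, 0 <= rho, rho < 1 & forall M, (0 < M)%N ->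
    Re `|bpart t M - rhp_pow (1 - t) (- l)| <= K * rho ^+ M].
Proof.
set q := Re `|t| => q1; have q0 : 0 <= q := Re_norm_ge0 t.
have Ret_le : `|Re t| <= q.
  by rewrite /q normc_def /= -sqrtr_sqr ler_wsqrtr// lerDl sqr_ge0.
(* Chosen so that r > 1 and still r q < 1; the rate [rho] is r q. *)
pose r := 2 / (1 + q).
have q1' : 0 < 1 + q by lra.
have r1 : 1 < r by rewrite /r ltr_pdivlMr//; lra.
have [K K0 KP] := bcoef_growth l_gt0 r1.
have w_gt0 (s : R) : 0 <= s <= 1 -> 0 < Re (1 - s%:C * t).
  move=> /andP[s0 s1]; rewrite raddfB /= -/(Re _) ReM_real subr_gt0.
  by apply: le_lt_trans q1; apply: le_trans Ret_le; apply: le_trans (ler_norm _) _; rewrite normrM ger0_norm// ler_piMl.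
pose E s := rhp_pow (1 - s%:C * t) l.
pose F := rhp_pow (1 - t) (- l).
have FE1 : F * E 1 = 1.
  by rewrite /F /E mul1r rhp_powN_mul//; have := w_gt0 1; rewrite mul1r; apply; lra.
have norm_w s : 0 <= s <= 1 -> 1 - q <= Re `|1 - s%:C * t| <= 2.
  move=> /andP[s0 s1].
  have sq : Re `|s%:C * t| <= q by rewrite Re_normM Re_norm_real// ler_piMl.
  have := Re_normD 1 (- (s%:C * t)); rewrite normrN.
  have := Re_normD (1 - s%:C * t) (s%:C * t); rewrite subrK.
  have -> : Re `|1 : C| = 1 by rewrite normr1.
  by move=> h1 h2; apply/andP; split; lra.
have mainb M : (0 < M)%N -> Re `|bpart t M * E 1 - 1| <= 2 * (M%:R * bcoef M * q ^+ M * (2 `^ l / (1 - q))).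
  move=> M0; pose P s := bpart (s%:C * t) M * E s.
  have dP s : 0 <= s <= 1 -> is_cderive s P
      (- (M%:R * (bcoef M)%:C * t ^+ M * s%:C ^+ M.-1) * E s / (1 - s%:C * t)).
    move=> s01; have ws := w_gt0 _ s01.
    have wn0 : 1 - s%:C * t != 0.
      by apply: contraTneq ws => ->; rewrite ltxx.
    have dw : is_cderive s (fun x => 1 - x%:C * t) (- t).
      have := is_cderiveD (is_cderive_cst s 1) (is_cderiveM (is_cderive_id s) (is_cderive_cst s (- t))).
      rewrite add0r mulr0 addr0 mul1r.
      by rewrite (_ : (fun x => _) = (fun x : R => 1 - x%:C * t))//; apply/funext => x; rewrite mulrN.
    have dE := is_cderive_rhp_pow l ws dw.
    have dS : is_cderive s (fun x => bpart (x%:C * t) M) (sdiff t M s).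
      rewrite (_ : (fun x => _) = fun x => \sum_(m < M) (bcoef m)%:C * t ^+ m * x%:C ^+ m); last first.
        by apply/funext => x; apply: eq_bigr => m _; rewrite exprMn [x%:C ^+ _ * _]mulrC mulrA.
      apply: (@is_cderive_sum _ s M (fun m x => (bcoef m)%:C * t ^+ m * x%:C ^+ m) (fun m => (bcoef m)%:C * t ^+ m * (m%:R * s%:C ^+ m.-1))) => m.
      have := is_cderiveM (is_cderive_cst s ((bcoef m)%:C * t ^+ m)) (is_cderiveX s m).
      by rewrite mul0r add0r.
    have := is_cderiveM dS dE; congr (is_cderive s P _).
    have -> : sdiff t M s = (l%:C * t * bpart (s%:C * t) M - M%:R * (bcoef M)%:C * t ^+ M * s%:C ^+ M.-1) / (1 - s%:C * t).
      by rewrite -sdiffE mulrC mulKf.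
    by rewrite -/(E s); field.
  have := @cderive_mvt _ P _ (M%:R * bcoef M * q ^+ M * (2 `^ l / (1 - q))) dP.
  have -> : P 1 = bpart t M * E 1 by rewrite /P mul1r.
  (* Here M > 0 matters: the empty partial sum would give 0. *)
  have -> : P 0 = 1.
    rewrite /P /E mul0r subr0 rhp_pow1 mulr1 /bpart.
    case: M M0 {P dP} => // M _; rewrite big_ord_recl expr0 mulr1 bcoef0.
    by rewrite big1 ?addr0// => i _; rewrite exprS mul0r mulr0.
  apply => s s01; have /andP[s0 s1] := s01; have /andP[w1 w2] := norm_w _ s01.
  rewrite !Re_normM normrN !Re_normM normfV.
  have -> : Re `|(M%:R : C)| = M%:R.
    by rewrite -(rmorph_nat (real_complex R)) Re_norm_real ?ler0n.
  rewrite Re_norm_real ?(ltW (bcoef_gt0 l_gt0 M))// -!mulrA ler_wpM2l ?ler0n//.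
  rewrite ler_wpM2l ?(ltW (bcoef_gt0 l_gt0 M))//.
  rewrite !Re_normX -/q ler_wpM2l ?exprn_ge0// Re_norm_real//.
  rewrite -[leRHS]mul1r ler_pM ?exprn_ge0//.
  - by rewrite mulr_ge0 ?Re_norm_ge0// [`|_ - _|]normc_Re -fmorphV /= invr_ge0 Re_norm_ge0.
  - by rewrite exprn_ile1.
  rewrite [`|1 - _|]normc_Re -fmorphV norm_rhp_pow ler_pM ?powR_ge0//=.
  - by rewrite invr_ge0 Re_norm_ge0.
  - by rewrite ge0_ler_powR ?nnegrE ?Re_norm_ge0// (ltW l_gt0).
  - by rewrite lef_pV2 ?posrE//; [apply: lt_le_trans w1|]; rewrite subr_gt0.
pose rho := r * q.
have rho1 : rho < 1 by rewrite /rho /r mulrAC ltr_pdivrMr//; lra.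
have rho0 : 0 <= rho by rewrite mulr_ge0// ltW// (lt_trans _ r1).
pose B := 2 `^ l / (1 - q).
have B0 : 0 <= B by rewrite divr_ge0 ?powR_ge0// subr_ge0 ltW.
exists (2 * (K * B) * Re `|F|), rho; split=> //.
  by apply: mulr_ge0 (Re_norm_ge0 _); apply: mulr_ge0 => //; apply: mulr_ge0 => //; exact: ltW.
move=> M M0; rewrite -/F.
have -> : bpart t M - F = (bpart t M * E 1 - 1) * F.
  by rewrite mulrBl mul1r -mulrA [E 1 * F]mulrC FE1 mulr1.
rewrite Re_normM [leRHS]mulrAC ler_wpM2r ?Re_norm_ge0//.
apply: le_trans (mainb M M0) _; rewrite -/B.
have h : M%:R * bcoef M <= K * r ^+ M.
  apply: le_trans (KP M).
  by rewrite ler_wpM2r ?(ltW (bcoef_gt0 l_gt0 M))// ler_nat leqnSn.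
have qB : 0 <= q ^+ M * B by rewrite mulr_ge0// exprn_ge0.
have := ler_wpM2l (ler0n R 2) (ler_wpM2r qB h).
have -> : rho ^+ M = r ^+ M * q ^+ M by exact: exprMn.
by congr (_ <= _); ring.
Qed.

End BinomialSeries.

(** * Limits of complex sequences *)

Section ComplexSequences.
Variable R : realType.
Local Notation C := R[i].
Implicit Types (u v : nat -> C) (a b : C).

Definition ccvg u a : Prop :=
  forall e : R, 0 < e -> exists N, forall M, (N <= M)%N -> Re `|u M - a| < e.

Lemma ccvg_cst a : ccvg (fun=> a) a.
Proof. by move=> e e0; exists 0%N => M _; rewrite subrr normr0. Qed.

Lemma ccvgD u v a b : ccvg u a -> ccvg v b -> ccvg (fun M => u M + v M) (a + b).
Proof.
move=> ua vb e e0; have e2 : 0 < e / 2 by rewrite divr_gt0.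
have [N NP] := ua _ e2; have [N' NP'] := vb _ e2.
exists (maxn N N') => M; rewrite geq_max => /andP[/NP h /NP' h'].
by rewrite opprD addrACA; apply: le_lt_trans (Re_normD _ _) _; lra.
Qed.

Lemma ccvgMl c u a : ccvg u a -> ccvg (fun M => c * u M) (c * a).
Proof.
move=> ua e e0; have c0 := Re_norm_ge0 c.
have c1 : 0 < Re `|c| + 1 by lra.
have [|N NP] := ua (e / (Re `|c| + 1)); first by rewrite divr_gt0.
exists N => M /NP; rewrite -mulrBr Re_normM ltr_pdivlMr// => h.
have := Re_norm_ge0 (u M - a); nra.
Qed.

Lemma ccvg_sum (I : Type) (r : seq I) (u : I -> nat -> C) (a : I -> C) :
  (forall i, ccvg (u i) (a i)) ->
  ccvg (fun M => \sum_(i <- r) u i M) (\sum_(i <- r) a i).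
Proof.
move=> ua; elim: r => [|i r IH].
  rewrite (_ : (fun M => _) = fun=> 0); first by rewrite big_nil; apply: ccvg_cst.
  by apply/funext => M; rewrite big_nil.
rewrite (_ : (fun M => _) = fun M => u i M + \sum_(j <- r) u j M).
  by rewrite big_cons; apply: ccvgD.
by apply/funext => M; rewrite big_cons.
Qed.

Lemma ccvg_shift u a (k : nat) : ccvg u a -> ccvg (fun M => u (M - k)%N) a.
Proof.
move=> ua e /ua[N NP]; exists (N + k)%N => M NM; apply: NP.
by rewrite leq_subRL ?(leq_trans (leq_addl N k))// addnC.
Qed.

(** In the order of R[i], 0 <= a includes that a is real, so both coordinates of the limit are
    controlled. *)
Lemma ccvg_ge0 u a : (forall M, 0 <= u M) -> ccvg u a -> 0 <= a.
Proof.
move=> u0 ua.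
have near (e : R) : 0 < e -> exists M : nat, `|Im a| < e /\ - e < Re a.
  move=> e0; have [N /(_ N (leqnn N)) h] := ua _ e0; exists N.
  have := u0 N; move: h; case: (u N) a {ua} => [x y] [z t].
  rewrite lecE /= => h /andP[/eqP y0 x0]; rewrite y0 in h.
  have hz : `|x - z| <= Num.sqrt ((x - z) ^+ 2 + (0 - t) ^+ 2).
    by rewrite -sqrtr_sqr ler_wsqrtr// lerDl sqr_ge0.
  have ht : `|0 - t| <= Num.sqrt ((x - z) ^+ 2 + (0 - t) ^+ 2).
    by rewrite -sqrtr_sqr ler_wsqrtr// lerDr sqr_ge0.
  split; first by rewrite -normrN -sub0r; exact: le_lt_trans ht h.
  have := le_lt_trans hz h; rewrite ltr_norml => /andP[? ?]; lra.
rewrite lecE; apply/andP; split.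
  apply/eqP; case: (eqVneq (Im a) 0) => // a0.
  have [|M []] := near `|Im a|; first by rewrite normr_gt0.
  by rewrite ltxx.
rewrite leNgt; apply/negP => a0.
have [|M [_]] := near (- Re a); first by rewrite oppr_gt0.
by rewrite opprK ltxx.
Qed.

Lemma expr_small (rho e : R) : 0 <= rho < 1 -> 0 < e ->
  exists N, forall M, (N <= M)%N -> rho ^+ M < e.
Proof.
move=> /andP[r0 r1] e0.
have rr : `|rho| < 1 by rewrite ger0_norm.
have := cvg_expr rr; move/cvgrPdist_lt => /(_ e e0)[N _ NP]; exists N => M NM.
by have := NP M NM; rewrite /= sub0r normrN ger0_norm// exprn_ge0.
Qed.

Lemma ccvg_geometric_rate u a (K rho : R) : 0 <= K -> 0 <= rho < 1 ->
  (forall M, (0 < M)%N -> Re `|u M - a| <= K * rho ^+ M) -> ccvg u a.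
Proof.
move=> K0 rho01 h e e0; have K1 : 0 < K + 1 by lra.
have [|N NP] := expr_small rho01 (_ : 0 < e / (K + 1)); first by rewrite divr_gt0.
exists N.+1 => M NM; apply: le_lt_trans (h _ (leq_ltn_trans (leq0n _) NM)) _.
have := NP _ (ltnW NM); rewrite ltr_pdivlMr//.
have : 0 <= rho ^+ M by case/andP: rho01 => ? _; apply: exprn_ge0.
by move: (rho ^+ M) => x x0 ?; nra.
Qed.

End ComplexSequences.

(** * Positive semidefinite kernels *)

Section PositiveKernels.
Variables (R : realType) (X : Type).
Local Notation C := R[i].
Implicit Types (Q : X -> X -> C) (s : seq (C * X)) (phi : X -> C).

Definition qform Q s : C :=
  \sum_(p <- s) \sum_(q <- s) p.1^# * q.1 * Q p.2 q.2.

Definition psd Q : Prop := forall s, 0 <= qform Q s.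

(** The adjoint of multiplication by phi sends K(., x) to conj(phi x) K(., x); this is its effect on
    the coefficients of a finite family. *)
Definition twist phi s : seq (C * X) := [seq (p.1 * (phi p.2)^#, p.2) | p <- s].

Lemma eq_qform Q Q' s : (forall x y, Q x y = Q' x y) -> qform Q s = qform Q' s.
Proof. by move=> QQ'; apply: eq_bigr => p _; apply: eq_bigr => q _; rewrite QQ'. Qed.

Lemma qform_twist phi Q s :
  qform Q (twist phi s) = qform (fun x y => phi x * (phi y)^# * Q x y) s.
Proof.
rewrite /qform big_map; apply: eq_bigr => p _; rewrite big_map.
by apply: eq_bigr => q _ /=; rewrite conjcM conjcK; ring.
Qed.

Lemma qformB c Q Q' s :
  qform (fun x y => c * Q x y - Q' x y) s = c * qform Q s - qform Q' s.
Proof.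
rewrite /qform mulr_sumr -sumrB; apply: eq_bigr => p _.
rewrite mulr_sumr -sumrB; apply: eq_bigr => q _; ring.
Qed.

Lemma psd_const1 : psd (fun _ _ => 1).
Proof.
move=> s; rewrite /qform.
have -> : \sum_(p <- s) \sum_(q <- s) p.1^# * q.1 * 1 =
    (\sum_(q <- s) q.1) * (\sum_(q <- s) q.1)^#.
  rewrite conjc_sum mulrC mulr_suml; apply: eq_bigr => p _.
  by rewrite mulr_sumr; apply: eq_bigr => q _; rewrite mulr1.
exact: mulcJ_ge0.
Qed.

(** A case of the Schur product theorem: each monomial of the series contributes a non-negative
    multiple of the form of Q on a twisted family, and non-negativity passes to the limit. *)
Lemma psd_mul_series phi Q (d : nat -> R) (kappa : X -> X -> C) :
  (forall m, 0 <= d m) ->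
  (forall x y, ccvg (fun M => \sum_(m < M) (d m)%:C * (phi x * (phi y)^#) ^+ m)
                    (kappa x y)) ->
  psd Q -> psd (fun x y => kappa x y * Q x y).
Proof.
move=> d0 dk Q0 s.
apply: (@ccvg_ge0 _ (fun M => \sum_(m < M) (d m)%:C * qform Q (twist (fun x => phi x ^+ m) s))).
  move=> M; apply: sumr_ge0 => m _; apply: mulr_ge0; first by rewrite ler0c.
  exact: Q0.
pose S x y M : C := \sum_(m < M) (d m)%:C * (phi x * (phi y)^#) ^+ m.
rewrite (_ : (fun M => _) = fun M => \sum_(p <- s) \sum_(q <- s)
    (p.1^# * q.1 * Q p.2 q.2) * S p.2 q.2 M).
  apply: ccvg_sum => p; apply: ccvg_sum => q.
  have -> : p.1^# * q.1 * (kappa p.2 q.2 * Q p.2 q.2) =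
    p.1^# * q.1 * Q p.2 q.2 * kappa p.2 q.2 by ring.
  by apply: ccvgMl; apply: dk.
apply/funext => M; transitivity (\sum_(m < M) \sum_(p <- s) \sum_(q <- s)
    (p.1^# * q.1 * Q p.2 q.2) * ((d m)%:C * (phi p.2 * (phi q.2)^#) ^+ m)).
  apply: eq_bigr => m _; rewrite qform_twist mulr_sumr; apply: eq_bigr => p _.
  rewrite mulr_sumr; apply: eq_bigr => q _; rewrite rmorphXn exprMn /=; ring.
rewrite exchange_big; apply: eq_bigr => p _; rewrite exchange_big.
by apply: eq_bigr => q _; rewrite mulr_sumr.
Qed.

End PositiveKernels.

(** * Membership, multipliers and resolvents in a reproducing kernel space *)

Section RkhsMembership.
Variables (R : realType) (T : choiceType) (D : set T).
Local Notation C := R[i].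
Variables (K : T -> T -> C) (H : set (T -> C)) (dot : (T -> C) -> (T -> C) -> C).
Hypothesis rH : rkhs D K H dot.
Local Notation X := {w : T | D w}.
Local Notation hsnorm := (hsnorm dot).
Implicit Types (s : seq (C * X)) (f : T -> C).

Let hH : hilbert_subspace H dot := rkhs_hilbert rH.

Definition ksec (x : X) : T -> C := (K^~ (sval x) : T -> C) \_ D.
Definition kcomb s : T -> C := \sum_(p <- s) p.1 *: ksec p.2.
(** The value that [dot f (kcomb s)] takes when f is in H; it makes sense for every function f. *)
Definition fcomb f s : C := \sum_(p <- s) p.1^# * f (sval p.2).

Lemma ksec_in x : H (ksec x).
Proof. by case: x => w Dw; apply: (rkhs_kernel rH). Qed.

Lemma kcomb_in s : H (kcomb s).
Proof. by apply: (hs_sum hH) => p _; apply: (hsZ hH); apply: ksec_in. Qed.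

Lemma dot_ksec f x : H f -> dot f (ksec x) = f (sval x).
Proof. by case: x => w Dw Hf; apply: (rkhs_reproducing rH). Qed.

Lemma dot_kcomb f s : H f -> dot f (kcomb s) = fcomb f s.
Proof.
move=> Hf; rewrite (dot_sumr hH)// => [|p]; last by apply: (hsZ hH); apply: ksec_in.
apply: eq_bigr => p _; rewrite (dotZr hH)// ?dot_ksec//; exact: ksec_in.
Qed.

Lemma kcomb_norm s : qform (fun x y => K (sval x) (sval y)) s = (hsnorm (kcomb s) ^+ 2)%:C.
Proof.
rewrite -(hsnorm_sqr hH (kcomb_in s)) dot_kcomb; last exact: kcomb_in.
apply: eq_bigr => p _; have pE : kcomb s (sval p.2) = \sum_(q <- s) q.1 * K (sval p.2) (sval q.2).
  rewrite /kcomb fct_sumE; apply: eq_bigr => q _.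
  transitivity (q.1 * ksec q.2 (sval p.2)) => //.
  by rewrite /ksec patchE mem_set//; case: (p.2).
by rewrite pE mulr_sumr; apply: eq_bigr => q _; rewrite mulrA.
Qed.

Lemma fcomb_le f s : H f -> Re `|fcomb f s| <= hsnorm f * hsnorm (kcomb s).
Proof.
move=> Hf; rewrite -dot_kcomb// -lecR -normc_Re.
exact: (cauchy_schwarz hH Hf (kcomb_in s)).
Qed.

(** The functional sending [kcomb s] to the conjugate of [fcomb f s] is represented by some v, and
    pairing v with kernel sections gives f = v. A graph is used because different s may have the
    same [kcomb s]. *)
Lemma rkhs_mem f (M : R) : (forall z, ~ D z -> f z = 0) ->
  (forall s, Re `|fcomb f s| <= M * hsnorm (kcomb s)) -> H f.
Proof.
move=> f0 fM.
pose G : set ((T -> C) * C) := [set p | exists s, p = (kcomb s, (fcomb f s)^#)].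
have [||||v Hv vP] := @riesz_graph _ _ _ _ hH G M.
- by move=> _ [s ->]; apply: kcomb_in.
- by exists [::]; rewrite /kcomb /fcomb !big_nil conjc0.
- move=> a _ _ [s ->] [t ->] /=; exists ([seq (a * p.1, p.2) | p <- s] ++ t).
  rewrite /kcomb /fcomb !big_cat !big_map /=; congr (_ + _, _).
    by rewrite scaler_sumr; apply: eq_bigr => p _; rewrite scalerA.
  rewrite conjcD; congr (_ + _); rewrite !conjc_sum mulr_sumr.
  by apply: eq_bigr => p _; rewrite !conjcM !conjcK mulrA.
- by move=> _ [s ->]; have := fM s; rewrite -(conjc_norm (fcomb f s)).
suff -> : f = v by [].
apply/funext => z; have [Dz|nDz] := pselect (D z); last first.
  by rewrite f0// (rkhs_supp rH Hv).
have Gz : G (ksec (exist _ z Dz), (f z)^#).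
  exists [:: (1, exist _ z Dz)].
  by rewrite /kcomb /fcomb !big_seq1 scale1r conjc1 mul1r.
have /= := vP _ Gz; rewrite (dotC hH Hv) ?dot_ksec//; last exact: ksec_in.
by move=> /(can_inj (@conjcK _)) ->.
Qed.

(** The positivity hypothesis says that the adjoint of multiplication by phi has norm at most c on
    the span of the kernel sections. *)
Lemma kcomb_twist_le (phi : X -> C) (c : R) s : 0 <= c ->
  psd (fun x y => ((c ^+ 2)%:C - phi x * (phi y)^#) * K (sval x) (sval y)) ->
  hsnorm (kcomb (twist phi s)) <= c * hsnorm (kcomb s).
Proof.
move=> c0 /(_ s); rewrite (@eq_qform _ _ _ (fun x y => (c ^+ 2)%:C * K (sval x) (sval y) -
   phi x * (phi y)^# * K (sval x) (sval y))); last by move=> x y; rewrite mulrBl.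
rewrite qformB -qform_twist !kcomb_norm -rmorphM -rmorphB ler0c subr_ge0 -exprMn.
by rewrite ler_pXn2r// nnegrE ?mulr_ge0 ?hsnorm_ge0.
Qed.

Lemma fcomb_twist (phi : X -> C) f g s : (forall x, g (sval x) = phi x * f (sval x)) ->
  fcomb g s = fcomb f (twist phi s).
Proof.
move=> gE; rewrite /fcomb big_map; apply: eq_bigr => p _ /=.
by rewrite gE conjcM conjcK mulrA.
Qed.

Lemma rkhs_multiplier (phi : X -> C) (c : R) f g : 0 <= c ->
  psd (fun x y => ((c ^+ 2)%:C - phi x * (phi y)^#) * K (sval x) (sval y)) ->
  H f -> (forall z, ~ D z -> g z = 0) ->
  (forall x, g (sval x) = phi x * f (sval x)) -> H g.
Proof.
move=> c0 cphi Hf g0 gE; apply: (@rkhs_mem _ (hsnorm f * c)) => // s.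
rewrite (fcomb_twist _ gE); apply: le_trans (fcomb_le _ Hf) _.
by rewrite -mulrA ler_wpM2l ?hsnorm_ge0// kcomb_twist_le.
Qed.

(* The Neumann series of 1 / (a - phi), summed inside the membership criterion;
   only the growth rate of the multiplier norms of the powers of phi matters. *)
Lemma rkhs_resolvent (phi : X -> C) (a : C) (c r : R) f g : 0 <= c -> 0 <= r ->
  r < Re `|a| -> 1 < Re `|a| -> (forall x, Re `|phi x| <= 1) ->
  (forall m, psd (fun x y => (((c * r ^+ m) ^+ 2)%:C - phi x ^+ m * (phi y ^+ m)^#)
                             * K (sval x) (sval y))) ->
  H f -> (forall z, ~ D z -> g z = 0) ->
  (forall x, g (sval x) = (a - phi x)^-1 * f (sval x)) -> H g.
Proof.
move=> c0 r0 ra a1 phi1 cphi Hf g0 gE.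
set al := Re `|a|; have al0 : 0 < al by apply: lt_trans a1.
have a0 : a != 0 by apply: contraTneq a1 => ->; rewrite normr0 -leNgt.
have aphi x : a - phi x != 0.
  rewrite subr_eq0; apply: contraTneq a1 => ->; rewrite -leNgt; exact: phi1.
apply: (@rkhs_mem _ (hsnorm f * (c / (al - r)))) => // s.
set N := hsnorm (kcomb s); have N0 : 0 <= N := hsnorm_ge0 _ _.
(* B bounds the remainder of the Neumann series for this fixed s, up to the factor |a|^(-M), as
   |phi| <= 1. It depends on s, but disappears when M tends to infinity. *)
pose B := \sum_(p <- s) Re `|p.1^# * f (sval p.2) / (a - phi p.2)|.
have step M : Re `|fcomb g s| <= hsnorm f * (c / (al - r)) * N + B * (al^-1) ^+ M.
  have -> : fcomb g s = \sum_(m < M) a^-1 ^+ m.+1 * fcomb f (twist (fun x => phi x ^+ m) s) +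
      \sum_(p <- s) p.1^# * f (sval p.2) / (a - phi p.2) * (phi p.2 / a) ^+ M.
    under eq_bigr do rewrite /fcomb big_map mulr_sumr.
    rewrite exchange_big -big_split /=; apply: eq_bigr => p _; rewrite gE.
    have geo : (a - phi p.2) * \sum_(m < M) a^-1 ^+ m.+1 * phi p.2 ^+ m = 1 - (phi p.2 / a) ^+ M.
      elim: M => [|M IH]; first by rewrite big_ord0 mulr0 expr0 subrr.
      rewrite big_ord_recr /= mulrDr IH !exprMn !exprS.
      by move: (a^-1 ^+ M) (phi p.2 ^+ M) => x y; field.
    have -> : \sum_(m < M) a^-1 ^+ m.+1 * ((p.1 * (phi p.2 ^+ m)^#)^# * f (sval p.2)) =
        p.1^# * f (sval p.2) * \sum_(m < M) a^-1 ^+ m.+1 * phi p.2 ^+ m.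
      by rewrite mulr_sumr; apply: eq_bigr => m _; rewrite conjcM conjcK; ring.
    apply: (mulfI (aphi p.2)); rewrite mulrDr mulrCA mulVKf//.
    rewrite [(a - _) * (_ * \sum_(m < M) _)]mulrCA geo; field; exact: aphi.
  apply: le_trans (Re_normD _ _) _; apply: lerD.
    apply: le_trans (Re_norm_sum _ _ _) _.
    apply: (@le_trans _ _ (\sum_(m < M) hsnorm f * c * N * (al^-1 ^+ m.+1 * r ^+ m))).
      apply: ler_sum => m _; rewrite Re_normM Re_normX Re_normV -/al.
      rewrite [leRHS]mulrCA ler_wpM2l ?exprn_ge0 ?invr_ge0 ?(ltW al0)//.
      apply: le_trans (fcomb_le _ Hf) _; rewrite -!mulrA ler_wpM2l ?hsnorm_ge0//.
      apply: le_trans (kcomb_twist_le s (_ : 0 <= c * r ^+ m) (cphi m)) _.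
        by rewrite mulr_ge0// exprn_ge0.
      by rewrite -/N -mulrA [r ^+ m * N]mulrC.
    have alr : 0 < al - r by rewrite subr_gt0.
    rewrite -mulr_sumr [leRHS](_ : _ = hsnorm f * c * N * (al - r)^-1); last by ring.
    rewrite ler_wpM2l ?mulr_ge0 ?hsnorm_ge0// -[leRHS]mul1r ler_pdivlMr//.
    (* The geometric sum is thus at most 1 / (|a| - r), uniformly in M. *)
    have -> : (\sum_(m < M) al^-1 ^+ m.+1 * r ^+ m) * (al - r) = 1 - (r / al) ^+ M.
      elim: M => [|M IH]; first by rewrite big_ord0 mul0r expr0 subrr.
      rewrite big_ord_recr /= mulrDl IH !exprMn !exprS.
      by move: (al^-1 ^+ M) (r ^+ M) => x y; field; rewrite gt_eqF.
    by rewrite gerBl exprn_ge0// divr_ge0// ltW.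
  rewrite /B mulr_suml; elim: (s) => [|p t IH]; first by rewrite !big_nil normr0.
  rewrite !big_cons; apply: le_trans (Re_normD _ _) _; apply: lerD => //.
  rewrite [leLHS]Re_normM ler_wpM2l ?Re_norm_ge0// Re_normX Re_normM Re_normV -/al.
  apply: lerXn2r; rewrite ?nnegrE ?mulr_ge0 ?Re_norm_ge0 ?invr_ge0 ?(ltW al0)//.
  by rewrite ler_piMl ?invr_ge0 ?(ltW al0).
rewrite leNgt; apply/negP => lt; set x := Re _ in lt step; set A := _ * N in lt step.
have B0 : 0 <= B by apply: sumr_ge0 => p _; apply: Re_norm_ge0.
have B1 : 0 < B + 1 by lra.
have [||M MP] := @expr_small R al^-1 ((x - A) / (B + 1)).
- by rewrite invr_ge0 ltW//= invf_lt1.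
- by rewrite divr_gt0// subr_gt0.
have := MP _ (leqnn M); rewrite /= ltr_pdivlMr//.
have : 0 <= al^-1 ^+ M by rewrite exprn_ge0// invr_ge0 ltW.
have := step M; move: (al^-1 ^+ M) => y *; nra.
Qed.

End RkhsMembership.

(** * Vieta's formula *)

Section ElementarySymmetric.
Variables (F : comNzRingType) (n : nat).

(** Expanding the product amounts to choosing the set S of factors that contribute - z j; these sets
    are grouped by cardinality. *)
Lemma prod_sub_elem_sym (a : F) (z : 'I_n -> F) :
  \prod_j (a - z j) =
  \sum_(k < n.+1) (-1) ^+ k * (\sum_(S : {set 'I_n} | #|S| == k) \prod_(j in S) z j)
                  * a ^+ (n - k).
Proof.
under eq_bigr do rewrite addrC.
rewrite bigA_distr (partition_big (fun S : {set 'I_n} => inord #|S| : 'I_n.+1) xpredT) //=.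
have ltS (S : {set 'I_n}) : (#|S| < n.+1)%N.
  by rewrite ltnS; apply: leq_trans (max_card _) _; rewrite card_ord.
apply: eq_bigr => k _; rewrite mulr_sumr mulr_suml; apply: eq_big => S.
  by rewrite -val_eqE /= inordK.
move=> /eqP Sk; have {}Sk : #|S| = k by rewrite -Sk inordK.
rewrite (bigID (mem S)) /= -Sk -prodrN; congr (_ * _).
  by apply: eq_bigr => i ->.
rewrite (eq_bigr (fun=> a)) => [|i /negPf -> //].
rewrite (eq_bigl (mem (~: S))) => [|i]; last by rewrite !inE.
by rewrite prodr_const cardsCs finset.setCK card_ord.
Qed.

End ElementarySymmetric.

(** * Operators on A^(lambda): multiplications, their inverses and permutations *)

Section WeightedBergman.
Variables (R : realType) (n : nat) (lambda : R).
Hypothesis lambda_gt0 : 0 < lambda.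
Local Notation C := R[i].
Local Notation V := ('rV[C]_n -> C).
Variables (A : set V) (dot : V -> V -> C).
Hypothesis hA : is_A_lambda lambda A dot.
Local Notation D := (@polydisc R n).
Local Notation X := {z : 'rV[C]_n | D z}.
Local Notation K := (polydisc_kernel lambda).

Let rA : rkhs D K A dot := hA.1.
Let hH : hilbert_subspace A dot := rkhs_hilbert rA.

Definition nneg_series (kappa : C -> C) : Prop := exists d : nat -> R,
  (forall m, 0 <= d m) /\
  forall t, Re `|t| < 1 -> ccvg (fun M => \sum_(m < M) (d m)%:C * t ^+ m) (kappa t).

Lemma binomial_ccvg t : Re `|t| < 1 ->
  ccvg (bpart lambda t) (rhp_pow (1 - t) (- lambda)).
Proof.
move=> /(binomial_series lambda_gt0)[K0 [rho [K00 rho0 rho1 h]]].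
by apply: (ccvg_geometric_rate K00 _ h); rewrite rho0.
Qed.

Lemma nneg_series_binomial : nneg_series (fun t => rhp_pow (1 - t) (- lambda)).
Proof.
exists (bcoef lambda); split; first by move=> m; apply/ltW/bcoef_gt0.
exact: binomial_ccvg.
Qed.

(** The coefficient of t^l is c r^m b_l - b_(l-m), the last term being absent for l < m; it is
    non-negative by [bcoef_shift_bound]. *)
Lemma nneg_series_binomial_sub (r : R) : 1 < r -> exists2 c, 0 < c & forall m,
  nneg_series (fun t => ((c * r ^+ m)%:C - t ^+ m) * rhp_pow (1 - t) (- lambda)).
Proof.
move=> r1; have [c c0 cP] := bcoef_shift_bound lambda_gt0 r1.
have r0 : 0 < r by apply: lt_trans r1.
exists c => // m.
exists (fun l => c * r ^+ m * bcoef lambda l - (if (m <= l)%N then bcoef lambda (l - m) else 0)).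
split=> [l|t t1].
  case: ifP => [ml|_]; last first.
    by rewrite subr0 !mulr_ge0 ?exprn_ge0 ?ltW// bcoef_gt0.
  by have := cP (l - m)%N m; rewrite subnK// subr_ge0.
have b := binomial_ccvg t1.
rewrite mulrBl -mulNr; have := ccvgD (ccvgMl (c * r ^+ m)%:C b) (ccvgMl (- t ^+ m) (ccvg_shift m b)).
congr (ccvg _ _); apply/funext => M; rewrite /bpart.
elim: M => [|M IH]; first by rewrite sub0n !big_ord0 !mulr0 addr0.
rewrite !big_ord_recr /= -IH; case: leqP => mM.
  rewrite subSn// big_ord_recr /= -[in t ^+ M](subnKC mM) exprD rmorphB !rmorphM /=.
  by ring.
have -> : (M.+1 - m = 0)%N by apply/eqP; rewrite subn_eq0.
have -> : (M - m = 0)%N by apply/eqP; rewrite subn_eq0 ltnW.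
by rewrite big_ord0 subr0 rmorphM; ring.
Qed.

Lemma polydisc_norm (x : X) j : Re `|sval x 0 j| < 1.
Proof. by case: x => z /= Dz; rewrite -ltcR -normc_Re. Qed.

Lemma psd_prod_series (kappa : 'I_n -> C -> C) : (forall j, nneg_series (kappa j)) ->
  psd (fun x y : X => \prod_j kappa j (sval x 0 j * (sval y 0 j)^#)).
Proof.
move=> hk.
suff: forall r : seq 'I_n, psd (fun x y : X => \prod_(j <- r) kappa j (sval x 0 j * (sval y 0 j)^#)) by exact.
elim=> [|j r IH] s.
  by rewrite (@eq_qform _ _ _ (fun _ _ => 1)) ?psd_const1// => x y; rewrite big_nil.
have [d [d0 dk]] := hk j.
rewrite (@eq_qform _ _ _ (fun x y : X => kappa j (sval x 0 j * (sval y 0 j)^#) *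
   \prod_(j <- r) kappa j (sval x 0 j * (sval y 0 j)^#))); last by move=> x y; rewrite big_cons.
apply: (@psd_mul_series _ _ (fun x : X => sval x 0 j) _ d (fun x y => kappa j (sval x 0 j * (sval y 0 j)^#))) => // x y.
apply: dk; rewrite Re_normM conjc_norm.
have := polydisc_norm x j; have := polydisc_norm y j.
have := Re_norm_ge0 (sval x 0 j); have := Re_norm_ge0 (sval y 0 j).
by move: (Re _) (Re _) => u v *; nra.
Qed.

(** The m-th power of multiplication by z_j has norm at most c r^m. Only the j-th factor of the
    kernel is affected; as the norm bound enters squared, the series is taken with r^2 and c is a
    square root. *)
Lemma psd_coord (r : R) : 1 < r -> exists2 c, 0 < c & forall j m,
  psd (fun x y : X => (((c * r ^+ m) ^+ 2)%:C - sval x 0 j ^+ m * (sval y 0 j ^+ m)^#)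
                      * K (sval x) (sval y)).
Proof.
move=> r1; have r2 : 1 < r ^+ 2 by rewrite expr_gt1// ltW// (lt_trans _ r1).
have [c c0 cP] := nneg_series_binomial_sub r2.
exists (Num.sqrt c) => [|j0 m s]; first by rewrite sqrtr_gt0.
pose kappa j t := (if j == j0 then (c * (r ^+ 2) ^+ m)%:C - t ^+ m else 1) * rhp_pow (1 - t) (- lambda).
rewrite (@eq_qform _ _ _ (fun x y : X => \prod_j kappa j (sval x 0 j * (sval y 0 j)^#))).
  apply: psd_prod_series => j; rewrite /kappa; case: (j == j0); first exact: cP.
  have [d [d0 dk]] := nneg_series_binomial; exists d; split=> // t t1.
  by rewrite mul1r; apply: dk.
move=> x y; rewrite /polydisc_kernel (bigD1 j0) //= [RHS](bigD1 j0) //= mulrA; congr (_ * _).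
  rewrite /kappa eqxx conjE exprMn sqr_sqrtr ?(ltW c0)// -!exprM [(2 * m)%N]mulnC.
  congr ((_ - _) * _); rewrite exprMn; congr (_ * _); exact: rmorphXn.
by apply: eq_bigr => j /negPf jj0; rewrite /kappa jj0 mul1r conjE.
Qed.

Lemma A_mul_coord j f : A f -> A (fun z => z 0 j * f z).
Proof.
move=> Af; have [c c0 /(_ j 1%N) cP] := psd_coord (ltr1n R 2 : 1 < 2%:R).
apply: (rkhs_multiplier rA (phi := fun x : X => sval x 0 j) _ cP Af) => // [|z nDz].
  by rewrite expr1 mulr_ge0// ltW.
by rewrite (rkhs_supp rA Af nDz) mulr0.
Qed.

Lemma A_coord_resolvent j a f : 1 < Re `|a| -> A f -> A (fun z => (a - z 0 j)^-1 * f z).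
Proof.
move=> a1 Af; pose r := (1 + Re `|a|) / 2.
have r1 : 1 < r by rewrite /r; lra.
have ra : r < Re `|a| by rewrite /r; lra.
have [c c0 /(_ j) cP] := psd_coord r1.
apply: (rkhs_resolvent rA (phi := fun x : X => sval x 0 j) (ltW c0) _ ra a1 _ cP Af) => //.
- by rewrite ltW// (lt_trans _ r1).
- by move=> x; apply/ltW/polydisc_norm.
- by move=> z nDz; rewrite (rkhs_supp rA Af nDz) mulr0.
Qed.

Lemma polydisc_perm (s : 'S_n) z : D (perm_act s z) <-> D z.
Proof.
split=> h j; last by rewrite mxE; apply: h.
by have := h (s j); rewrite mxE permK.
Qed.

Lemma kernel_perm (s : 'S_n) z w : K (perm_act s z) (perm_act s w) = K z w.
Proof.
rewrite /polydisc_kernel [RHS](reindex_inj (@perm_inj _ s^-1%g)).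
by apply: eq_bigr => j _; rewrite !mxE.
Qed.

(** The kernel is invariant under permuting both arguments, so permuting the points of a finite
    family preserves the norm of its kernel combination. *)
Lemma A_perm (s : 'S_n) f : A f -> A (fun z => f (perm_act s z)).
Proof.
move=> Af; apply: (rkhs_mem rA (M := hsnorm dot f)) => [z nDz|t].
  by apply: (rkhs_supp rA Af) => /polydisc_perm.
pose sg (x : X) : X := exist _ (perm_act s (sval x)) (iffRL (polydisc_perm s _) (svalP x)).
pose t' := [seq (p.1, sg p.2) | p <- t].
have -> : fcomb (fun z => f (perm_act s z)) t = fcomb f t'.
  by rewrite /fcomb big_map.
suff -> : hsnorm dot (kcomb K t) = hsnorm dot (kcomb K t') by apply: (fcomb_le rA).
apply/eqP; rewrite -(@eqrXn2 _ 2)// ?hsnorm_ge0//; apply/eqP/complexI.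
rewrite -!(kcomb_norm rA) /qform big_map; apply: eq_bigr => p _; rewrite big_map.
by apply: eq_bigr => q _ /=; rewrite kernel_perm.
Qed.

(** The constant 1 is the kernel section at the origin. *)
Lemma A_one : A (((fun=> 1) : V) \_ D).
Proof.
have D0 : D 0 by move=> j; rewrite mxE normr0 ltr01.
have := rkhs_kernel rA D0; congr (A (_ \_ D)); apply/funext => z.
rewrite /polydisc_kernel big1// => j _.
by rewrite mxE conjE conjc0 mulr0 subr0 rhp_pow1.
Qed.

Lemma A_mul_prod_coord (P : pred 'I_n) f : A f -> A (fun z => (\prod_(j | P j) z 0 j) * f z).
Proof.
move=> Af; elim: (index_enum _) => [|j r IH].
  by have := Af; congr A; apply/funext => z; rewrite big_nil mul1r.
case: (boolP (P j)) => Pj.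
  have := (A_mul_coord j IH); congr A; apply/funext => z.
  by rewrite big_cons Pj mulrA.
by have := IH; congr A; apply/funext => z; rewrite big_cons (negPf Pj).
Qed.

Lemma A_mul_elem_sym k f : A f -> A (fun z => elem_sym k z * f z).
Proof.
move=> Af.
rewrite (_ : (fun z => _) = \sum_(S : {set 'I_n} | #|S| == k) (fun z : 'rV[C]_n => (\prod_(j in S) z 0 j) * f z)).
  by apply: (hs_sum hH) => S _; apply: A_mul_prod_coord.
by apply/funext => z; rewrite fct_sumE /elem_sym mulr_suml.
Qed.

Lemma A_mul_affine j c f : A f -> A (fun z => (z 0 j - c) * f z).
Proof.
move=> Af; have := hsB hH (A_mul_coord j Af) (hsZ hH c Af).
by congr A; apply/funext => z; rewrite mulrBl.
Qed.

Lemma A_mul_prod (r : seq ('I_n * C)) f : A f ->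
  A (fun z => (\prod_(p <- r) (z 0 p.1 - p.2)) * f z).
Proof.
move=> Af; elim: r => [|p r IH].
  by have := Af; congr A; apply/funext => z; rewrite big_nil mul1r.
by have := (A_mul_affine p.1 p.2 IH); congr A; apply/funext => z; rewrite big_cons mulrA.
Qed.

Lemma A_div_prod a f : 1 < Re `|a| -> A f -> A (fun z => (\prod_j (a - z 0 j))^-1 * f z).
Proof.
move=> a1 Af; elim: (index_enum _) => [|j r IH].
  by have := Af; congr A; apply/funext => z; rewrite big_nil invr1 mul1r.
have := (A_coord_resolvent j a1 IH); congr A; apply/funext => z.
by rewrite big_cons invfM mulrA.
Qed.

End WeightedBergman.

(** * The symmetrization map: roots, fibres and generic points *)

Section SymmetrizationMap.
Variables (R : realType) (n : nat).
Local Notation C := R[i].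
Implicit Types (z w : 'rV[C]_n).

Definition root_poly z : {poly C} := \prod_j ('X - (z 0 j)%:P).

Lemma elem_sym0 z : elem_sym 0 z = 1.
Proof.
rewrite /elem_sym (big_pred1 finset.set0) => [|S]; last by rewrite cards_eq0.
by rewrite big_pred0// => j; rewrite inE.
Qed.

Lemma root_poly_elem_sym z : root_poly z =
  \sum_(k < n.+1) ((-1) ^+ k * elem_sym k z) *: 'X^(n - k).
Proof.
rewrite /root_poly (prod_sub_elem_sym _ (fun j => (z 0 j)%:P)); apply: eq_bigr => k _.
rewrite -mul_polyC polyCM rmorphXn rmorphN1; congr (_ * _ * _).
by rewrite /elem_sym rmorph_sum; apply: eq_bigr => S _; rewrite rmorph_prod.
Qed.

Lemma horner_root_poly z a : (root_poly z).[a] = \prod_j (a - z 0 j).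
Proof. by rewrite horner_prod; apply: eq_bigr => j _; rewrite hornerXsubC. Qed.

Lemma coef_rev_sum (c : nat -> C) k : (k <= n)%N ->
  (\sum_(l < n.+1) c l *: 'X^(n - l))`_(n - k) = c k.
Proof.
move=> kn; rewrite coef_sum (bigD1 (Ordinal (kn : (k < n.+1)%N))) //= big1 => [|l].
  by rewrite addr0 coefZ coefXn eqxx mulr1.
rewrite -val_eqE /= => lk; rewrite coefZ coefXn; case: eqP => [|_]; last by rewrite mulr0.
have ln : (l <= n)%N by rewrite -ltnS.
move=> e; case/eqP: lk; move/(congr1 (subn n)): e; by rewrite !subKn.
Qed.

Lemma coef_root_poly z k : (k <= n)%N -> (root_poly z)`_(n - k) = (-1) ^+ k * elem_sym k z.
Proof. by move=> kn; rewrite root_poly_elem_sym (coef_rev_sum (fun k => (-1) ^+ k * elem_sym k z)). Qed.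

Lemma root_poly_perm (s : 'S_n) z : root_poly (perm_act s z) = root_poly z.
Proof.
rewrite /root_poly [RHS](reindex_inj (@perm_inj _ s^-1%g)).
by apply: eq_bigr => j _; rewrite mxE.
Qed.

Lemma elem_sym_perm (s : 'S_n) z (k : 'I_n) :
  elem_sym k.+1 (perm_act s z) = elem_sym k.+1 z.
Proof.
apply: (@mulfI _ ((-1) ^+ k.+1)); first by rewrite signr_eq0.
by rewrite -!coef_root_poly ?ltn_ord// root_poly_perm.
Qed.

(** The coordinates of w are the roots of the monic polynomial whose signed coefficients are the
    entries of mu. *)
Lemma symmetrization_surj (mu : 'rV[C]_n) : exists w, symmetrization w = mu.
Proof.
(* m 0 = 1 is the leading coefficient; the default 0 is never reached for k <= n. *)
pose m k : C := if k is k'.+1 then (if insub k' is Some i then mu 0 i else 0) else 1.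
pose p : {poly C} := \sum_(k < n.+1) ((-1) ^+ k * m k) *: 'X^(n - k).
have pE k : (k <= n)%N -> p`_(n - k) = (-1) ^+ k * m k.
  exact: (coef_rev_sum (fun k => (-1) ^+ k * m k)).
have pn : p`_n = 1 by have := pE 0%N (leq0n _); rewrite subn0 expr0 mul1r.
have szp : size p = n.+1.
  apply/eqP; rewrite eqn_leq; apply/andP; split; last first.
    rewrite leqNgt; apply/negP => sz; move: pn; rewrite nth_default// => /eqP.
    by rewrite eq_sym oner_eq0.
  apply: (leq_trans (size_sum _ _ _)); apply/bigmax_leqP => k _.
  by apply: (leq_trans (size_scale_leq _ _)); rewrite size_polyXn ltnS leq_subr.
have lcp : lead_coef p = 1 by rewrite lead_coefE szp.
have [r pr] := closed_field_poly_normal p; rewrite lcp scale1r in pr.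
have szr : size r = n by apply/eqP; rewrite -eqSS -szp pr size_prod_XsubC.
pose w : 'rV[C]_n := \row_j r`_j.
have wp : root_poly w = p.
  rewrite pr (big_nth 0) szr big_mkord; apply: eq_bigr => j _.
  by rewrite mxE.
exists w; apply/rowP => k; rewrite mxE.
apply: (@mulfI _ ((-1) ^+ k.+1)); first by rewrite signr_eq0.
rewrite -coef_root_poly ?ltn_ord// wp pE ?ltn_ord//.
by rewrite /m insubT //= => h; congr (_ * mu _ _); apply: val_inj.
Qed.

(* The coefficients come from evaluating at a root a = w_j the polynomial with
   roots z minus the one with roots w. *)
Lemma root_poly_combination z w (j : 'I_n) :
  \prod_l (w 0 j - z 0 l) = \sum_(k < n) ((-1) ^+ k.+1 * w 0 j ^+ (n - k.+1)) *
     (elem_sym k.+1 z - symmetrization w 0 k).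
Proof.
have hw : \prod_l (w 0 j - w 0 l) = 0 by rewrite (bigD1 j) //= subrr mul0r.
rewrite -[LHS]subr0 -[X in _ - X]hw -!horner_root_poly !root_poly_elem_sym.
rewrite !horner_sum -sumrB big_ord_recl !elem_sym0 subrr add0r.
apply: eq_bigr => k _; rewrite !hornerZ !hornerXn mxE lift0; ring.
Qed.

(** The factors are replaced one at a time; all moduli being at most 1, each replacement costs at
    most e. *)
Lemma prod_dist (I : Type) (r : seq I) (P : pred I) (a b : I -> C) (e : R) :
  (forall i, Re `|a i| <= 1) -> (forall i, Re `|b i| <= 1) ->
  (forall i, Re `|a i - b i| <= e) -> 0 <= e ->
  Re `|\prod_(i <- r | P i) a i - \prod_(i <- r | P i) b i| <= (size r)%:R * e.
Proof.
move=> a1 b1 ab e0.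
have p1 (c : I -> C) : (forall i, Re `|c i| <= 1) -> forall t, Re `|\prod_(i <- t | P i) c i| <= 1.
  move=> c1 t; elim/big_ind: _ => [|x y x1 y1|i _]; rewrite ?normr1//.
  have := Re_norm_ge0 x; have := Re_norm_ge0 y; rewrite Re_normM; nra.
elim: r => [|i r IH]; first by rewrite !big_nil subrr normr0 mul0r.
have re0 : 0 <= (size r)%:R * e by rewrite mulr_ge0.
rewrite !big_cons; case: (P i); last first.
  by apply: le_trans IH _; rewrite ler_wpM2r// ler_nat leqnSn.
set x := \prod_(_ <- _ | _) _ in IH *; set y := \prod_(_ <- _ | _) _ in IH *.
have -> : a i * x - b i * y = a i * (x - y) + (a i - b i) * y by ring.
apply: le_trans (Re_normD _ _) _; rewrite !Re_normM [size (_ :: _)]/= -natr1 mulrDl mul1r.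
have y1 : Re `|y| <= 1 by apply: p1.
apply: lerD; first by apply: le_trans IH; rewrite ler_piMl ?Re_norm_ge0.
by apply: le_trans (ab i); rewrite ler_piMr ?Re_norm_ge0.
Qed.

Lemma elem_sym_lipschitz : exists2 B : R, 0 <= B & forall k z w (e : R), 0 <= e ->
  (forall j, Re `|z 0 j| <= 1) -> (forall j, Re `|w 0 j| <= 1) ->
  (forall j, Re `|z 0 j - w 0 j| <= e) -> Re `|elem_sym k z - elem_sym k w| <= B * e.
Proof.
pose N : R := (size (index_enum 'I_n))%:R.
exists (\sum_(S : {set 'I_n}) N); first by apply: sumr_ge0 => S _; rewrite ler0n.
move=> k z w e e0 z1 w1 zw; rewrite /elem_sym -sumrB mulr_suml.
apply: le_trans (Re_norm_sum _ _ _) _; rewrite big_mkcond /=; apply: ler_sum => S _.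
case: ifP => _; last by rewrite mulr_ge0// ler0n.
exact: prod_dist.
Qed.

(** A nonzero p has fewer than [size p] roots, so one of the [size p] distinct points e / (k+2) is
    not a root. *)
Lemma poly_nonroot_small (p : {poly C}) (e : R) : p != 0 -> 0 < e ->
  exists2 t : R, 0 < t < e & p.[t%:C] != 0.
Proof.
move=> p0 e0; apply: contrapT => h.
pose rs := [seq (e / k.+2%:R)%:C | k <- iota 0 (size p)].
have tk k : 0 < e / k.+2%:R < e.
  by rewrite divr_gt0 ?ltr0Sn//= ltr_pdivrMr ?ltr0Sn// ltr_pMr// ltr1n.
have : (size rs < size p)%N.
  apply: max_poly_roots => //.
    apply/allP => _ /mapP[k _ ->]; apply/negPn/negP => hk.
    by apply: h; exists (e / k.+2%:R).
  rewrite map_inj_uniq ?iota_uniq// => k l /complexI /(mulfI (lt0r_neq0 e0)) /invr_inj.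
  by move/eqP; rewrite eqr_nat => /eqP[].
by rewrite size_map size_iota ltnn.
Qed.

(** z lies on the segment from w to a point v of the polydisc with distinct coordinates, close to
    w. *)
Lemma generic_approx w (e : R) : closed_polydisc w -> 0 < e -> exists z,
  [/\ polydisc z, injective (fun j => z 0 j) &
      forall k, Re `|elem_sym k z - elem_sym k w| < e].
Proof.
move=> w1 e0; have {}w1 j : Re `|w 0 j| <= 1 by rewrite -lecR -normc_Re; apply: w1.
pose v (j : 'I_n) : C := (j%:R / n.+1%:R : R)%:C.
have v1 j : Re `|v j| < 1.
  rewrite Re_norm_real ?divr_ge0// ltr_pdivrMr ?ltr0Sn// mul1r ltr_nat.
  exact: leq_trans (ltn_ord j) _.
have vinj : injective v.
  move=> j l /complexI /(mulIf _) h; apply/val_inj/eqP; rewrite -(eqr_nat R).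
  by apply/eqP/h; rewrite invr_eq0 pnatr_eq0.
(* At t, q is the product of the coordinate differences of (1 - t) w + t v; as q(1) is nonzero,
   coordinates coincide for finitely many t only. *)
pose q : {poly C} := \prod_(u : 'I_n * 'I_n | u.1 != u.2)
   ((w 0 u.1 - w 0 u.2)%:P + 'X * ((v u.1 - v u.2) - (w 0 u.1 - w 0 u.2))%:P).
have qE t : q.[t] = \prod_(u : 'I_n * 'I_n | u.1 != u.2)
    (((1 - t) * w 0 u.1 + t * v u.1) - ((1 - t) * w 0 u.2 + t * v u.2)).
  rewrite horner_prod; apply: eq_bigr => u _.
  by rewrite hornerD hornerM !hornerC hornerX; ring.
have q0 : q != 0.
  apply/negP => /eqP q0; have := qE 1; rewrite q0 horner0 => /esym/eqP/prodf_eq0[u u12].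
  by rewrite subrr !mul0r !add0r !mul1r subr_eq0 => /eqP/vinj/eqP; rewrite (negPf u12).
have [B B0 BP] := elem_sym_lipschitz.
have B1 : 0 < B + 1 by lra.
(* t < 1 keeps z in the polydisc; |z_j - w_j| <= 2 t makes the change in each s_k at most 2 B t <
   e. *)
pose e' := Num.min 1 (e / (2 * (B + 1))).
have e'0 : 0 < e' by rewrite lt_min ltr01 divr_gt0// mulr_gt0.
have [t /andP[t0 te] qt] := poly_nonroot_small q0 e'0.
move: te; rewrite lt_min => /andP[t1 te].
pose z : 'rV[C]_n := \row_j ((1 - t%:C) * w 0 j + t%:C * v j).
have z1 j : Re `|z 0 j| < 1.
  rewrite mxE; apply: le_lt_trans (Re_normD _ _) _; rewrite !Re_normM.
  have -> : 1 - t%:C = (1 - t)%:C by rewrite rmorphB.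
  rewrite (@Re_norm_real _ (1 - t)) ?subr_ge0 ?(ltW t1)// (@Re_norm_real _ t) ?(ltW t0)//.
  have := w1 j; have := v1 j; move: (Re _) (Re _) => x y; nra.
exists z; split=> [j|j l|k].
- by rewrite normc_Re ltcR.
- move=> zjl; apply/eqP/negPn/negP => jl; move: qt; rewrite qE.
  by move/prodf_neq0/(_ (j, l) jl) => /=; move: zjl; rewrite /z !mxE => ->; rewrite subrr eqxx.
apply: (@le_lt_trans _ _ (B * (2 * t))).
  apply: BP => // [|j|j]; [by rewrite mulr_ge0// ltW|exact/ltW/z1|].
  have -> : z 0 j - w 0 j = t%:C * (v j - w 0 j) by rewrite mxE; ring.
  rewrite Re_normM Re_norm_real ?(ltW t0)// mulrC ler_pM2r//.
  apply: le_trans (Re_normD _ _) _; rewrite normrN.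
  have := w1 j; have := v1 j; lra.
move: te; rewrite ltr_pdivlMr ?mulr_gt0//; nra.
Qed.

End SymmetrizationMap.

(** * The image W of the projection and its Koszul complexes *)

Section IsotypicSpectrum.
Variables (R : realType) (n : nat) (lambda : R).
Hypothesis lambda_gt0 : 0 < lambda.
Local Notation C := R[i].
Local Notation V := ('rV[C]_n -> C).
Variables (A : set V) (dot : V -> V -> C).
Hypothesis hA : is_A_lambda lambda A dot.
Variables (d : nat) (rho : mx_representation C [set: 'S_n]%G d) (i0 : 'I_d).
Local Notation D := (@polydisc R n).
Local Notation P := (isotypic_proj rho i0).
Local Notation W := (P @` A).

Let hH : hilbert_subspace A dot := rkhs_hilbert hA.1.

Lemma isotypic_projE f : P f = (d%:R / n`!%:R : C) *:
  \sum_(s : 'S_n) rho (s^-1)%g i0 i0 *: (fun z => f (perm_act (s^-1)%g z) : C).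
Proof.
apply/funext => z; rewrite /isotypic_proj; congr (_ * _).
by rewrite fct_sumE.
Qed.

Lemma isotypic_proj_in f : A f -> A (P f).
Proof.
move=> Af; rewrite isotypic_projE; apply: (hsZ hH); apply: (hs_sum hH) => s _.
by apply: (hsZ hH); apply: (A_perm hA).
Qed.

(** A symmetric g is constant along the orbit averaged by P, so W is stable under any symmetric
    multiplier of A. *)
Lemma isotypic_proj_mul (g f : V) : (forall s z, g (perm_act s z) = g z) ->
  P (fun z => g z * f z) = fun z => g z * P f z.
Proof.
move=> gs; apply/funext => z; rewrite /isotypic_proj mulrCA; congr (_ * _).
by rewrite mulr_sumr; apply: eq_bigr => s _; rewrite gs mulrCA.
Qed.

Lemma isotypic_proj_linear a f g : P (a *: f + g) = a *: P f + P g.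
Proof.
apply/funext => z; rewrite /isotypic_proj.
transitivity (d%:R / n`!%:R * (a * (\sum_s rho (s^-1)%g i0 i0 * f (perm_act (s^-1)%g z)) +
  \sum_s rho (s^-1)%g i0 i0 * g (perm_act (s^-1)%g z))).
  congr (_ * _); rewrite mulr_sumr -big_split /=; apply: eq_bigr => s _.
  by rewrite mulrDr mulrCA.
by rewrite mulrDr mulrCA.
Qed.

Lemma isotypic_linear a f g : W f -> W g -> W (a *: f + g).
Proof.
move=> [u Au <-] [v Av <-]; exists (a *: u + v); last exact: isotypic_proj_linear.
exact: (hs_linear hH).
Qed.

Lemma isotypic0 : W 0.
Proof.
exists 0; first exact: hs_zero hH.
rewrite isotypic_projE big1 ?scaler0// => s _.
by apply/funext => z; exact: mulr0.
Qed.

Lemma isotypicZ a f : W f -> W (a *: f).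
Proof. by move=> Wf; rewrite -[_ *: _]addr0; apply: isotypic_linear => //; apply: isotypic0. Qed.

Lemma isotypic_sum (I : Type) (r : seq I) (Q : pred I) (F : I -> V) :
  (forall i, Q i -> W (F i)) -> W (\sum_(i <- r | Q i) F i).
Proof.
move=> WF; elim/big_rec: _ => [|i x Qi Wx]; first exact: isotypic0.
by rewrite -[F i]scale1r; apply: isotypic_linear => //; apply: WF.
Qed.

Lemma isotypic_supp f z : W f -> ~ D z -> f z = 0.
Proof. by move=> [u Au <-] nDz; apply: (rkhs_supp hA.1 (isotypic_proj_in Au) nDz). Qed.

Lemma isotypic_mul_sym (k : 'I_n) f : W f -> W (mul_sym k f).
Proof.
move=> [u Au <-]; exists (mul_sym k u); first exact: (A_mul_elem_sym lambda_gt0 hA).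
by apply: isotypic_proj_mul => s z; apply: elem_sym_perm.
Qed.

Lemma koszul_mul_sym (mu : 'rV[C]_n) (x : {set 'I_n} -> V) S z :
  koszul (fun k v => mul_sym k v - mu 0 k *: v) x S z =
  skoszul (fun k => elem_sym k.+1 z - mu 0 k) (fun S' => x S' z) S.
Proof.
rewrite /koszul fct_sumE; apply: eq_bigr => k kS.
by rewrite mulrBl.
Qed.

Lemma isotypic_koszul (mu : 'rV[C]_n) (x : {set 'I_n} -> V) S : (forall S', W (x S')) ->
  W (koszul (fun k v => mul_sym k v - mu 0 k *: v) x S).
Proof.
move=> Wx; apply: isotypic_sum => k _; apply: isotypicZ.
by rewrite addrC -scaleNr; apply: isotypic_linear => //; apply: isotypic_mul_sym.
Qed.

Lemma taylor_nonsingular_of_root (w : 'rV[C]_n) (j : 'I_n) : 1 < Re `|w 0 j| ->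
  taylor_nonsingular W (fun k v => mul_sym k v - symmetrization w 0 k *: v).
Proof.
move=> wj; set a := w 0 j; pose h (z : 'rV[C]_n) : C := \prod_l (a - z 0 l).
have hs s z : h (perm_act s z) = h z.
  by rewrite /h -!horner_root_poly root_poly_perm.
have h0 z : D z -> h z != 0.
  move=> Dz; apply/prodf_neq0 => l _; rewrite subr_eq0.
  by apply: contraTneq wj => al; rewrite -/a al -leNgt -lecR -normc_Re ltW// Dz.
have Wdiv f : W f -> W (fun z => (h z)^-1 * f z).
  move=> [u Au <-]; exists (fun z => (h z)^-1 * u z); first exact: (A_div_prod lambda_gt0 hA).
  by apply: (@isotypic_proj_mul (fun z => (h z)^-1)) => s z; rewrite hs.
pose c (k : 'I_n) : C := (-1) ^+ k.+1 * a ^+ (n - k.+1).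
have hE z : h z = \sum_k c k * (elem_sym k.+1 z - symmetrization w 0 k).
  exact: root_poly_combination.
apply/seteqP; split=> [x [Wx kx0]|_ [y Wy <-]].
  (* The homotopy applied to the cycle x leaves only the differential of the contraction, equal to
     [h z] times x; dividing by h gives a preimage. *)
  pose y S : V := fun z => (h z)^-1 * scontract c (fun S' => x S' z) S.
  have Wy S : W (y S).
    apply: (Wdiv (fun z => scontract c (fun S' => x S' z) S)).
    rewrite (_ : (fun z => _) = \sum_(k in ~: S) (ksign _ k S * c k) *: x (k |: S)).
      by apply: isotypic_sum => k _; apply: isotypicZ.
    by apply/funext => z; rewrite fct_sumE; apply: eq_bigr => k _; rewrite mulrA.
  exists y => //; apply/funext => S; apply/funext => z; rewrite koszul_mul_sym.
  set t := fun k : 'I_n => elem_sym k.+1 z - symmetrization w 0 k.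
  have -> : skoszul t (fun S' => y S' z) S = (h z)^-1 * skoszul t (scontract c (fun S' => x S' z)) S.
    by rewrite /skoszul mulr_sumr; apply: eq_bigr => k _; rewrite /y; ring.
  have := skoszul_homotopy t c (fun S' => x S' z) S.
  have -> : scontract c (skoszul t (fun S' => x S' z)) S = 0.
    apply: big1 => k _; rewrite -koszul_mul_sym (kx0 (k |: S)).
    by rewrite !mulr0.
  (* Off the polydisc h may vanish, but x is 0 there. *)
  rewrite addr0 -hE => ->; have [Dz|nDz] := pselect (D z).
    by rewrite mulKf// h0.
  by rewrite (isotypic_supp (Wx S) nDz) !mulr0.
split=> [S|S]; first exact: isotypic_koszul.
apply/funext => z; rewrite koszul_mul_sym.
rewrite (_ : (fun S' => _) = skoszul (fun k => elem_sym k.+1 z - symmetrization w 0 k) (fun S' => y S' z)).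
  exact: skoszul_skoszul.
by apply/funext => S'; rewrite koszul_mul_sym.
Qed.

(** A family concentrated on the full index set is a cycle, since [S :\ k] with k in S is never
    full; its preimage is read at the sets missing one index. *)
Lemma top_degree_exact (mu : 'rV[C]_n) f :
  taylor_nonsingular W (fun k v => mul_sym k v - mu 0 k *: v) -> A f ->
  exists2 Y : 'I_n -> V, forall k, A (Y k) & forall z,
    P f z = \sum_k ksign _ k [set: 'I_n]%SET * ((elem_sym k.+1 z - mu 0 k) * P (Y k) z).
Proof.
move=> ex Af; pose x (S : {set 'I_n}) : V := if S == [set: 'I_n]%SET then P f else 0.
have : [set x | (forall S, W (x S)) /\
    forall S, koszul (fun k v => mul_sym k v - mu 0 k *: v) x S = 0] x.
  split=> S; first by rewrite /x; case: ifP => _; [exists f|exact: isotypic0].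
  apply/funext => z; rewrite koszul_mul_sym; apply: big1 => k kS.
  rewrite /x ifF ?mulr0//; apply/negbTE/eqP => /setP/(_ k).
  by rewrite !inE eqxx.
rewrite ex => -[y Wy yx].
have /choice[Y YP] : forall k : 'I_n, exists u, A u /\ P u = y ([set: 'I_n]%SET :\ k)%SET.
  by move=> k; have [u Au uE] := Wy ([set: 'I_n]%SET :\ k)%SET; exists u.
exists Y => [k|z]; first by case: (YP k).
have -> : P f = x [set: 'I_n]%SET by rewrite /x eqxx.
rewrite -yx koszul_mul_sym; apply: eq_big => [k|k _]; first by rewrite inE.
by have [_ ->] := YP k.
Qed.

(** The product of all z_j - w_l with j != l vanishes at every permutation of w except w itself, so
    P keeps only the identity term, whose matrix entry is 1. *)
Lemma isotypic_nonvanishing (w : 'rV[C]_n) : D w -> injective (fun j => w 0 j) ->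
  exists2 f, A f & P f w != 0.
Proof.
move=> Dw winj.
pose r := [seq (u.1, w 0 u.2) | u <- enum [pred u : 'I_n * 'I_n | u.1 != u.2]].
pose f : V := fun z => (\prod_(p <- r) (z 0 p.1 - p.2)) * (((fun=> 1) : V) \_ D) z.
exists f; first by apply: (A_mul_prod lambda_gt0 hA); apply: (A_one hA).
have Dp s : D (perm_act s w) by apply/polydisc_perm.
have fE s : f (perm_act s w) = \prod_(p <- r) (perm_act s w 0 p.1 - p.2).
  by rewrite /f patchE mem_set// mulr1.
rewrite /isotypic_proj (bigD1 1%g) //= [X in _ + X]big1 => [|s s1]; last first.
  rewrite fE; suff -> : \prod_(p <- r) (perm_act (s^-1)%g w 0 p.1 - p.2) = 0 by rewrite mulr0.
  have [j sj] : exists j, s j != j.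
    have [/existsP//|] := boolP [exists j, s j != j].
    rewrite negb_exists => /forallP sj; case/eqP: s1; apply/permP => j.
    by rewrite perm1; apply/eqP; have := sj j; rewrite negbK.
  apply/eqP; rewrite prodf_seq_eq0; apply/hasP; exists (j, w 0 (s j)).
    by apply/mapP; exists (j, s j) => //; rewrite mem_enum inE /= eq_sym.
  by rewrite /= mxE invgK subrr.
rewrite addr0 invg1 repr_mx1 mxE eqxx mul1r mulf_neq0//.
  rewrite mulf_neq0 ?invr_eq0 ?pnatr_eq0//; last by rewrite -lt0n fact_gt0.
  by rewrite -lt0n (leq_ltn_trans _ (ltn_ord i0)).
rewrite fE prodf_seq_neq0; apply/allP => _ /mapP[[j l] jl ->] /=.
rewrite mxE invg1 perm1 subr_eq0; apply/eqP => /winj jl'.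
by move: jl; rewrite mem_enum inE /= jl' eqxx.
Qed.

(** P f at w is a finite combination of values of f at the permutations of w, hence the pairing of f
    with a combination of kernel sections. *)
Lemma isotypic_eval_repr (w : 'rV[C]_n) : D w ->
  exists2 g, A g & forall f, A f -> dot f g = P f w.
Proof.
move=> Dw; have Dp s : D (perm_act s w) by apply/polydisc_perm.
pose x s : {z | D z} := exist _ (perm_act (s^-1)%g w) (Dp (s^-1)%g).
pose c (s : 'S_n) : C := (d%:R / n`!%:R * rho (s^-1)%g i0 i0)^#.
pose g := kcomb (polydisc_kernel lambda) [seq (c s, x s) | s <- index_enum 'S_n].
exists g; first exact: (kcomb_in hA.1).
move=> f Af; rewrite (dot_kcomb hA.1)// /fcomb big_map /isotypic_proj mulr_sumr.
by apply: eq_bigr => s _ /=; rewrite /c conjcK mulrA.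
Qed.

Lemma taylor_singular_on_Gamma (w : 'rV[C]_n) : closed_polydisc w ->
  ~ taylor_nonsingular W (fun k v => mul_sym k v - symmetrization w 0 k *: v).
Proof.
move=> w1 ex.
have /choice[z zP] : forall m : nat, exists z : 'rV[C]_n, [/\ D z, injective (fun j => z 0 j) &
      forall k, Re `|elem_sym k z - elem_sym k w| < m.+1%:R^-1].
  by move=> m; apply: generic_approx => //; rewrite invr_gt0 ltr0Sn.
have Dz m : D (z m) by case: (zP m).
have /choice[g gP] : forall m, exists g, A g /\ forall f, A f -> dot f g = P f (z m).
  by move=> m; have [g Ag gE] := isotypic_eval_repr (Dz m); exists g.
have Ag m : A (g m) by case: (gP m).
have gE m f : A f -> dot f (g m) = P f (z m) by case: (gP m) => _; apply.
have g0 m : g m != 0.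
  have [_ zi _] := zP m; have [f Af] := isotypic_nonvanishing (Dz m) zi.
  by rewrite -gE//; apply: contraNneq => ->; rewrite (dot0r hH).
have [||f Af fP] := gliding_hump hH (delta := fun m => m.+1%:R^-1) Ag g0.
- by move=> m; rewrite invr_ge0 ler0n.
- by move=> e e0; have [m] := ltr_add_invr e0; rewrite add0r; exists m.
have [Y AY YE] := top_degree_exact ex Af.
(* Exactness bounds |P f (z m)| by the sum of |s_k(z m) - s_k(w)| |P (Y k) (z m)|, at most this
   constant times |g m| / (m+1), against the choice of f. *)
have [m] := fP (\sum_k hsnorm dot (Y k)).
apply/negP; rewrite -leNgt gE// YE.
apply: le_trans (Re_norm_sum _ _ _) _; rewrite -mulrA mulr_suml; apply: ler_sum => k _.
have sgn : Re `|ksign C k [set: 'I_n]%SET| = 1 by rewrite /ksign normrX normrN1 expr1n.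
rewrite Re_normM sgn mul1r Re_normM [leRHS]mulrCA.
apply: ler_pM; rewrite ?Re_norm_ge0//.
  by rewrite mxE; case: (zP m) => _ _ h; apply/ltW/h.
by rewrite -(gE m (Y k) (AY k)) -lecR -normc_Re; apply: (cauchy_schwarz hH).
Qed.

End IsotypicSpectrum.

(** * The two inclusions between the Taylor spectrum and Gamma *)

Theorem theorem3p9 (R : realType) (n : nat) (n_ge1 : (1 <= n)%N)
    (lambda : R) (lambda_gt0 : 0 < lambda)
    (A : set ('rV[R[i]]_n -> R[i]))
    (dot : ('rV[R[i]]_n -> R[i]) -> ('rV[R[i]]_n -> R[i]) -> R[i])
    (A_lambda : is_A_lambda lambda A dot)
    (p : seq nat) (p_part : is_partition_of n p)
    (d : nat) (rho : mx_representation R[i] [set: 'S_n]%G d)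
    (rho_unitary : unitary_repr rho) (rho_p : in_specht_class p rho)
    (i : 'I_d) :
  taylor_spectrum (isotypic_proj rho i @` A) (@mul_sym R n) = @Gamma R n.
Proof.
apply/seteqP; split=> [mu|_ [w w1 <-]]; last first.
  exact: (taylor_singular_on_Gamma lambda_gt0 A_lambda).
move=> sp; apply: contrapT => muG; apply: sp.
have [w wmu] := symmetrization_surj mu.
(* Otherwise w would lie in the closed polydisc and mu in Gamma. *)
have [j wj] : exists j, 1 < Re `|w 0 j|.
  apply: contrapT => nw; apply: muG; exists w => // j.
  rewrite normc_Re lecR leNgt; apply/negP => wj; by apply: nw; exists j.
by rewrite -wmu; exact: (taylor_nonsingular_of_root lambda_gt0 A_lambda rho i wj).
Qed.
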